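(* Let $(\epsilon_n)_{n\ge1}$ be an arbitrary sequence of positive real numbers. Then there exist an integer $m\ge1$ and a homogeneous self-similar iterated function system $\Phi=\{\varphi_j(x)=\lambda x+t_j\}_{j=0}^m$ on $\mathbb{R}$ (with a common contraction $\lambda\in(-1,1)\setminus\{0\}$ and $t_j\in\mathbb{R}$) such that: (1) $\lambda$ is a rational number; (2) $\Phi$ has no exact overlaps; (3) $\Delta_n\le\epsilon_n$ for all $n\ge1$; (4) $\dim_s\Phi<1$, and in particular $\beta(\Phi,p)<1$ for every probability vector $p=(p_j)_{j=0}^m$ with strictly positive coordinates; (5) $\dim\mu(\Phi,p)=\beta(\Phi,p)$ for every probability vector $p=(p_j)_{j=0}^m$ with strictly positive coordinates; (6) $\dim_H K=\dim_s\Phi$, where $K$ is the attractor of $\Phi$.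
   Context: Logarithms are to base $2$. Let $\Phi=\{\varphi_j(x)=\lambda_jx+t_j\}_{j=0}^m$ be a self-similar iterated function system on $\mathbb{R}$ ($\lambda_j\in(-1,1)\setminus\{0\}$, $t_j\in\mathbb{R}$); it is homogeneous if all $\lambda_j$ are equal. Write $\Lambda=\{0,\dots,m\}$, and for $w=j_1\dots j_n\in\Lambda^n$ write $\varphi_w=\varphi_{j_1}\circ\dots\circ\varphi_{j_n}$ and $\lambda_w=\lambda_{j_1}\cdots\lambda_{j_n}$. Exact overlaps: $\Phi$ has exact overlaps if there exist $n\ge1$ and distinct $w_1,w_2\in\Lambda^n$ with $\varphi_{w_1}=\varphi_{w_2}$. $\Delta_n=\min\{|\varphi_{w_1}(0)-\varphi_{w_2}(0)| : w_1,w_2\in\Lambda^n,\ w_1\ne w_2,\ \lambda_{w_1}=\lambda_{w_2}\}$. The attractor $K$ is the unique nonempty compact $K\subset\mathbb{R}$ with $K=\bigcup_{j=0}^m\varphi_j(K)$; $\dim_H$ is Hausdorff dimension; $\dim_s\Phi$ is the unique $s\ge0$ with $\sum_{j=0}^m|\lambda_j|^s=1$. For a probability vector $p=(p_j)_{j=0}^m$ with strictly positive coordinates, $\mu(\Phi,p)$ is the unique Borel probability measure $\mu$ on $\mathbb{R}$ with $\mu=\sum_{j=0}^m p_j\cdot\varphi_j\mu$ ($\varphi_j\mu$ is the push-forward). It is known to be exact dimensional, and $\dim\mu$ denotes the number with $\dim\mu=\lim_{\delta\downarrow0}\frac{\log\mu(x-\delta,x+\delta)}{\log\delta}$ for $\mu$-a.e.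 $x$. Finally $\beta(\Phi,p)=\min\{1,H(p)/\chi\}$ with $H(p)=-\sum_{j=0}^m p_j\log p_j$ and $\chi=-\sum_{j=0}^m p_j\log|\lambda_j|$. *)

(* Defs.v *)
From HB Require Import structures.
From mathcomp Require Import all_boot all_order all_algebra.
From mathcomp Require Import all_classical all_reals all_analysis.
Set Implicit Arguments.
Unset Strict Implicit.
Unset Printing Implicit Defensive.
Import Order.TTheory GRing.Theory Num.Theory.
Import numFieldTopology.Exports numFieldNormedType.Exports.

Local Open Scope classical_set_scope.
Local Open Scope ring_scope.

Definition log2 {R : realType} (x : R) : R := ln x / ln 2.

(** * Self-similar iterated function systems on the line *)

(* The index set {0, ..., m} is ['I_m.+1]. *)
Record ifs (R : realType) (m : nat) := Ifs {
  ifs_ratio : 'I_m.+1 -> R;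
  ifs_trans : 'I_m.+1 -> R;
  ifs_ratio_neq0 : forall j, ifs_ratio j != 0;
  ifs_ratio_lt1 : forall j, `|ifs_ratio j| < 1 }.

Section Systems.
Context {R : realType} {m : nat} (Phi : ifs R m).

Definition homogeneous : Prop := forall i j, ifs_ratio Phi i = ifs_ratio Phi j.

Definition ifs_map (j : 'I_m.+1) (x : R) : R := ifs_ratio Phi j * x + ifs_trans Phi j.

Definition word_map (w : seq 'I_m.+1) : R -> R :=
  foldr (fun j f => ifs_map j \o f) id w.

Definition word_ratio (w : seq 'I_m.+1) : R := \prod_(j <- w) ifs_ratio Phi j.

Definition exact_overlaps : Prop :=
  exists n : nat, (1 <= n)%N /\
  exists w1 w2 : n.-tuple 'I_m.+1, w1 <> w2 /\ word_map w1 = word_map w2.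

(* A minimum over a finite set, in the extended reals so that the minimum over
   the empty set is +oo. *)
Definition Delta (n : nat) : \bar R :=
  \big[Order.min/+oo%E]_(w : n.-tuple 'I_m.+1 * n.-tuple 'I_m.+1 |
      (w.1 != w.2) && (word_ratio w.1 == word_ratio w.2))
    `|word_map w.1 0 - word_map w.2 0|%:E.

Definition is_attractor (K : set R) : Prop :=
  [/\ K !=set0, compact K & K = \bigcup_j (ifs_map j @` K)].

(* By Hutchinson's theorem exactly one set is an attractor, so the default value
   is never used; the same holds for the measure below. *)
Definition attractor : set R := xget set0 [set K | is_attractor K].

Definition is_similarity_dim (s : R) : Prop :=
  0 <= s /\ \sum_j `|ifs_ratio Phi j| `^ s = 1.

Definition similarity_dim : R := xget 0 [set s | is_similarity_dim s].

(* The next two lemmas show that [similarity_dim] is well defined. *)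
Lemma similarity_dimP : is_similarity_dim similarity_dim.
Proof.
suff : exists s, is_similarity_dim s by move=> [s hs]; exact: (xgetI 0 hs).
pose f (s : R) := \sum_j `|ifs_ratio Phi j| `^ s.
have f0 : 1 <= f 0.
  rewrite /f (eq_bigr (fun=> 1)) => [|j _]; last by rewrite powRr0.
  by rewrite sumr_const card_ord ler1n.
have cf : continuous f.
  apply: (@continuous_big _ _ _ _ _ _ _ _ (fun j s => `|ifs_ratio Phi j| `^ s)).
    exact: add_continuous.
  move=> j _ s; have rj : `|ifs_ratio Phi j| == 0 = false.
    by rewrite normr_eq0 (negbTE (ifs_ratio_neq0 Phi j)).
  rewrite /powR rj; apply: continuous_comp; last exact: continuous_expR.
  exact: mulrr_continuous.
have [b b0 fb] : exists2 b, 0 <= b & f b <= 1.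
  pose b := \sum_j ln (m.+1%:R : R) / - ln `|ifs_ratio Phi j|.
  have lm : 0 <= ln (m.+1%:R : R) by rewrite ln_ge0 // ler1n.
  have lr j : 0 < - ln `|ifs_ratio Phi j|.
    by rewrite oppr_gt0 ln_lt0 // normr_gt0 ifs_ratio_neq0 ifs_ratio_lt1.
  have tj j : 0 <= ln (m.+1%:R : R) / - ln `|ifs_ratio Phi j|.
    by rewrite divr_ge0 // ltW.
  exists b; first exact: sumr_ge0.
  have le j : `|ifs_ratio Phi j| `^ b <= m.+1%:R^-1.
    rewrite /powR normr_eq0 (negbTE (ifs_ratio_neq0 Phi j)).
    rewrite -[leRHS]lnK ?posrE ?invr_gt0 ?ltr0n // ler_expR lnV ?posrE ?ltr0n //.
    rewrite lerNr -mulrN -ler_pdivrMr // /b (bigD1 j) //= lerDl.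
    exact: sumr_ge0.
  apply: le_trans (ler_sum _ (fun j _ => le j)) _.
  by rewrite sumr_const card_ord -(mulr_natr (m.+1%:R^-1)) mulVf // pnatr_eq0.
have [||c] := @IVT R f 0 b 1 b0.
- exact: continuous_subspaceT.
- by rewrite ge_min fb orbT le_max f0.
by rewrite in_itv /= => /andP[c0 _] fc; exists c.
Qed.

Lemma similarity_dim_unique s : is_similarity_dim s -> s = similarity_dim.
Proof.
have key a b : is_similarity_dim a -> is_similarity_dim b -> a < b -> False.
  move=> [_ fa] [_ fb] ab; have := ltxx (1 : R); rewrite -{1}fb -{}fa.
  suff -> : \sum_j `|ifs_ratio Phi j| `^ b < \sum_j `|ifs_ratio Phi j| `^ a by [].
  apply: ltr_sum => [|j _]; first by apply/hasP; exists ord0; rewrite ?mem_index_enum.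
  rewrite /powR normr_eq0 (negbTE (ifs_ratio_neq0 Phi j)) ltr_expR.
  by rewrite ltr_nM2r // ln_lt0 // normr_gt0 ifs_ratio_neq0 ifs_ratio_lt1.
move=> hs; have ht := similarity_dimP.
by case: (ltgtP s similarity_dim) => // [/(key _ _ hs ht)|/(key _ _ ht hs)].
Qed.

Definition pos_prob_vector (p : 'I_m.+1 -> R) : Prop :=
  (forall j, 0 < p j) /\ \sum_j p j = 1.

Definition entropy (p : 'I_m.+1 -> R) : R := - \sum_j p j * log2 (p j).

Definition lyapunov (p : 'I_m.+1 -> R) : R :=
  - \sum_j p j * log2 `|ifs_ratio Phi j|.

Definition beta (p : 'I_m.+1 -> R) : R :=
  Order.min 1 (entropy p / lyapunov p).

(* [measurableTypeR R] is R with its Borel sigma-algebra. *)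
Definition is_self_similar (p : 'I_m.+1 -> R)
    (mu : probability (measurableTypeR R) R) : Prop :=
  forall A : set (measurableTypeR R), measurable A ->
    mu A = (\sum_j (p j)%:E * pushforward mu (ifs_map j) A)%E.

Definition self_similar_measure (p : 'I_m.+1 -> R) :
    probability (measurableTypeR R) R :=
  xget (dirac (0 : measurableTypeR R) : probability (measurableTypeR R) R)
    [set mu | is_self_similar p mu].

End Systems.

(** * Dimension of measures and sets *)

Section Dimension.
Context {R : realType}.

Definition is_exact_dim (mu : probability (measurableTypeR R) R) (d : R) :
    Prop :=
  {ae mu, forall x : measurableTypeR R,
    (log2 (fine (mu [set` `]x - delta, x + delta[])) / log2 delta)
      @[delta --> (0 : R)^'+] --> d}.

(* A number [d] as in [is_exact_dim] is necessarily nonnegative, so the value -1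
   marks the measures that are not exact dimensional. *)
Definition measure_dim (mu : probability (measurableTypeR R) R) : R :=
  xget (-1) [set d | is_exact_dim mu d].

(* Equal to -oo on the empty set. *)
Definition diam (U : set R) : \bar R :=
  ereal_sup [set `|x.1 - x.2|%:E | x in U `*` U].

(* Convention: the empty set contributes 0 and a nonempty set U contributes
   (diam U)^s, with 0^0 = 1. *)
Definition hausdorff_weight (s : R) (U : set R) : \bar R :=
  if U == set0 then 0%E else poweR (diam U) s.

Definition hausdorff_content (s delta : R) (A : set R) : \bar R :=
  ereal_inf [set (\sum_(0 <= i <oo) hausdorff_weight s (U i))%E |
    U in [set U : (set R)^nat |
      A `<=` \bigcup_i U i /\ forall i, (diam (U i) <= delta%:E)%E]].

(* The limit as delta decreases to 0 is a supremum, by monotonicity. *)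
Definition hausdorff_measure (s : R) (A : set R) : \bar R :=
  ereal_sup [set hausdorff_content s delta A | delta in [set d : R | 0 < d]].

Definition hausdorff_dim (A : set R) : \bar R :=
  ereal_inf [set s%:E | s in [set s : R | 0 <= s /\ hausdorff_measure s A = 0%E]].

End Dimension.

(* Main.v *)
Require Import Defs.
From HB Require Import structures.
From mathcomp Require Import all_boot all_order all_algebra archimedean.
From mathcomp Require Import all_classical all_reals all_analysis.
From mathcomp Require Import measurable_realfun.
From mathcomp Require Import zify ring lra.
Import Order.TTheory GRing.Theory Num.Theory.
Import numFieldTopology.Exports numFieldNormedType.Exports.
Set Implicit Arguments.
Unset Strict Implicit.
Unset Printing Implicit Defensive.

(* The system has ratio 1/10 and translations 0, 1, 3, 7, tau, sigma. Both
   parameters are limits of rational numbers tau_k and sigma_k for which there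
   are exact overlaps; tau_k and sigma_k are refined alternately, each one after
   the length of the next overlap of the other is known, so that at every length
   one of the two overlaps persists up to the prescribed error.

   No dimension is lost because at most exp(o(n)) words of length n have their
   values within O(10^-n) of a given point. This multiplicity is submultiplicative
   in n, so it is enough to bound it for one length at every stage, and there it is
   stable under small changes of the parameters. For tau_k and sigma_k themselves,
   words of equal values are decoded 10-adically, starting from the last letter:
   tau_k and sigma_k are 10-adically close to 3 + 10 + ... + 10^k and
   7 + 10 + ... + 10^k (and really close to tau and sigma), whence a digit is
   ambiguous at most once in k + 1 steps, and the multiplicity is about
   2^(n / (k + 1)).

   Subexponential multiplicity excludes exact overlaps, which would make it
   exponential. With the law of large numbers in Chernoff's form and the
   Borel-Cantelli lemma it yields the local dimension of every self-similar
   measure, and with the mass distribution principle the Hausdorff dimension. *)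

Local Open Scope ring_scope.

(** * Words and decimal decoding *)

Section Words.
Context {A : finType}.

Fixpoint words (n : nat) : seq (seq A) :=
  if n is k.+1 then [seq a :: w | a <- enum A, w <- words k] else [:: [::]].

Lemma mem_words n w : (w \in words n) = (size w == n).
Proof.
elim: n w => [|n IH] w /=; first by rewrite mem_seq1; case: w.
apply/allpairsP/eqP => [[[a u] /= [_ + ->]]|].
  by rewrite IH => /eqP /= ->.
by case: w => // a w [sw]; exists (a, w); rewrite mem_enum IH sw.
Qed.

Lemma uniq_words n : uniq (words n).
Proof.
elim: n => //= n IH; apply: allpairs_uniq => //; first exact: enum_uniq.
by move=> [a u] [b v] _ _ /= [-> ->].
Qed.

Lemma size_words n : size (words n) = (#|A| ^ n)%N.
Proof. by elim: n => //= n IH; rewrite size_allpairs IH -cardE expnS. Qed.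

Section Big.
Context {R : Type} {idx : R} (op : Monoid.com_law idx).
Implicit Type F : seq A -> R.

Lemma big_words0 F : \big[op/idx]_(w <- words 0) F w = F [::].
Proof. by rewrite big_seq1. Qed.

Lemma big_wordsS n F :
  \big[op/idx]_(w <- words n.+1) F w =
  \big[op/idx]_a \big[op/idx]_(w <- words n) F (a :: w).
Proof. by rewrite /= big_allpairs_dep big_enum. Qed.

Lemma big_words_cat n k F :
  \big[op/idx]_(w <- words (n + k)) F w =
  \big[op/idx]_(w <- words n) \big[op/idx]_(u <- words k) F (w ++ u).
Proof.
elim: n F => [|n IH] F; first by rewrite big_words0.
by rewrite addSn !big_wordsS; apply: eq_bigr => a _; exact: IH.
Qed.

Lemma big_words1 F :
  \big[op/idx]_(w <- words 1) F w = \big[op/idx]_a F [:: a].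
Proof. by rewrite big_wordsS; apply: eq_bigr => a _; rewrite big_words0. Qed.

Lemma big_words_rcons n F :
  \big[op/idx]_(w <- words n.+1) F w =
  \big[op/idx]_(w <- words n) \big[op/idx]_a F (rcons w a).
Proof.
rewrite -addn1 big_words_cat; apply: eq_bigr => w _.
by rewrite big_words1; apply: eq_bigr => a _; rewrite cats1.
Qed.

End Big.

Lemma prod_words_sum (R : comPzSemiRingType) (f : A -> R) n :
  \sum_(w <- words n) \prod_(a <- w) f a = (\sum_a f a) ^+ n.
Proof.
elim: n => [|n IH]; first by rewrite big_words0 big_nil expr0.
rewrite big_wordsS exprS mulr_suml; apply: eq_bigr => a _.
by rewrite -IH mulr_sumr; apply: eq_bigr => w _; rewrite big_cons.
Qed.

End Words.

(** * Decoding integers from their lowest decimal digit *)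

Section Decimal.
Local Open Scope int_scope.

Fixpoint repunit (k : nat) : int :=
  if k is k'.+1 then 1 + 10 * repunit k' else 0.

Context {T : 'I_6 -> int} {L : nat}.

Let letter (i : nat) : 'I_6 := inord i.

(** At length 0 the remainder is not tested, so the words are counted whose value agrees with [c]
    modulo 10^l. This may overcount the words of value [c], but only digits matter. *)
Fixpoint decodings (l : nat) (c : int) : nat :=
  if l is l'.+1 then
    (\sum_(a < 6 | (10 %| (c - T a)%R)%Z) decodings l' ((c - T a)%R %/ 10)%Z)%N
  else 1%N.

Definition int_value (w : seq 'I_6) : int :=
  foldl (fun z a => 10 * z + T a) 0 w.

Lemma count_int_value l c :
  (\sum_(w <- words l) (int_value w == c) <= decodings l c)%N.
Proof.
elim: l c => [|l IH] c; first by rewrite big_words0 leq_b1.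
rewrite big_words_rcons exchange_big /= [leqRHS]big_mkcond leq_sum // => a _.
have E w : int_value (rcons w a) = 10 * int_value w + T a.
  by rewrite /int_value -cats1 foldl_cat.
case: ifPn => [h|h].
  rewrite (leq_trans _ (IH _)) // leq_sum // => w _.
  rewrite E; case: eqP => //= <-.
  by rewrite addrK mulKz ?eqxx.
rewrite leqn0 big1 // => w _; rewrite E; case: eqP => // e.
by rewrite -e addrK dvdz_mulr ?dvdzz in h.
Qed.

Hypothesis T_mod : forall a : 'I_6,
  (10 ^+ L.+1 %| T a - nth 0 [:: 0; 1; 3; 7; 3 + 10 * repunit L; 7 + 10 * repunit L] a)%Z.

(** The exponent is [l / L.+1] rounded up: one binary choice per block of [L.+1] digits. *)
Let bound (l : nat) : nat := (2 ^ ((l + L) %/ L.+1))%N.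

Let bound_mono i j : (i <= j)%N -> (bound i <= bound j)%N.
Proof. by move=> ij; rewrite /bound leq_pexp2l // leq_div2r // leq_add2r. Qed.

Let bound0 : bound 0 = 1%N.
Proof. by rewrite /bound add0n divn_small. Qed.

(** An ambiguous digit followed by [L] unambiguous ones fills a block, which is worth one factor 2.
    For [l < L] the truncated difference is 0, and the block that has been started pays for the
    factor. *)
Let bound_double l : (2 * bound (l - L) <= bound l.+1)%N.
Proof.
have [lL|Ll] := leqP L l.
  rewrite /bound subnK // -expnS leq_exp2l //.
  by rewrite (_ : l.+1 + L = l + L.+1)%N ?divnDr ?dvdnn ?divnn ?addn1 ?addnS.
have -> : (l - L = 0)%N by apply/eqP; exact: ltnW.
rewrite bound0 muln1 /bound (@leq_pexp2l 2 1) //.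
by rewrite divn_gt0 // addSn ltnS leq_addl.
Qed.



(** [T a] is split into its last digit and a carry [e a]. Modulo 10^L, the letters 0 and 1 have the
    same carry, while 4 and 5 repeat the digits of 2 and 3 with a carry larger by a repunit. *)
Let digits : exists e : 'I_6 -> int,
  [/\ forall a, T a = nth 0 [:: 0; 1; 3; 7; 3; 7] a + 10 * e a,
      (10 ^+ L %| e (letter 1) - e (letter 0))%Z,
      (10 ^+ L %| e (letter 4) - e (letter 2) - repunit L)%Z &
      (10 ^+ L %| e (letter 5) - e (letter 3) - repunit L)%Z].
Proof.
have /fin_all_exists [q hq] (a : 'I_6) : exists q : int,
  T a = nth 0 [:: 0; 1; 3; 7; 3 + 10 * repunit L; 7 + 10 * repunit L] a
        + 10 ^+ L.+1 * q.
  have /dvdzP [q hq] := T_mod a; exists q.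
  by rewrite [_ * q]mulrC -hq addrC subrK.
exists (fun a : 'I_6 => nth 0 [:: 0; 0; 0; 0; repunit L; repunit L] a +
                 10 ^+ L * q a); split.
- move=> a; rewrite hq exprS -mulrA mulrDr addrA; congr (_ + _).
  by case: a => [[|[|[|[|[|[|//]]]]]]] ? /=; rewrite ?mulr0 ?addr0.
- by rewrite !inordK //= !add0r -mulrBr dvdz_mulr.
- by rewrite !inordK //= add0r addrAC [_ + _ * _]addrC addrK -mulrBr dvdz_mulr.
- by rewrite !inordK //= add0r addrAC [_ + _ * _]addrC addrK -mulrBr dvdz_mulr.
Qed.

Let next_digit (f : int -> nat) (r d q e : int) :
  0 <= r < 10 -> 0 <= d < 10 ->
  (if (10 %| (r + 10 * q - (d + 10 * e))%R)%Z
   then f ((r + 10 * q - (d + 10 * e))%R %/ 10)%Z else 0%N) =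
  (if r == d then f (q - e) else 0%N).
Proof.
move=> r10 d10; have -> : (10 %| (r + 10 * q - (d + 10 * e))%R)%Z = (r == d) by lia.
by case: eqP => // ->; congr f; lia.
Qed.

Let decodingsS (e : 'I_6 -> int) l (r q : int) :
  (forall a, T a = nth 0 [:: 0; 1; 3; 7; 3; 7] a + 10 * e a) ->
  0 <= r < 10 ->
  decodings l.+1 (r + 10 * q) =
  (if r == 0 then decodings l (q - e (letter 0)) else
   if r == 1 then decodings l (q - e (letter 1)) else
   if r == 3 then decodings l (q - e (letter 2)) + decodings l (q - e (letter 4)) else
   if r == 7 then decodings l (q - e (letter 3)) + decodings l (q - e (letter 5)) else
   0)%N.
Proof.
move=> eT r10; rewrite /= big_mkcond /=.
under eq_bigr => i _.
  rewrite eT next_digit //; last by case: i => [[|[|[|[|[|[|//]]]]]]].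
  over.
have E (i : 'I_6) : e i = e (letter i) by rewrite /letter inord_val.
under eq_bigr do rewrite E.
rewrite !big_ord_recl big_ord0 /= /bump /= !addn0.
rewrite -[letter (1 + 1)%N]/(letter 2) -[letter (1 + (1 + 1))%N]/(letter 3).
rewrite -[letter (1 + (1 + (1 + 1)))%N]/(letter 4).
rewrite -[letter (1 + (1 + (1 + (1 + 1))))%N]/(letter 5).
by do !case: eqP => ?; lia.
Qed.

Let decompose (c : int) : exists r q : int, 0 <= r < 10 /\ c = r + 10 * q.
Proof. by exists (c %% 10)%Z, (c %/ 10)%Z; lia. Qed.

(** For [j > 0] the last digit of [c'] follows that of [c], and 0, 1 is the only pair of consecutive
    digits among 0, 1, 3, 7. In that case the quotients differ by a repunit with one digit less; in
    all others one of the counts vanishes. The maximum covers both outcomes: one branch dies, or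
    both last [j] steps. *)
Let decodings_pair e m :
  (forall a, T a = nth 0 [:: 0; 1; 3; 7; 3; 7] a + 10 * e a) ->
  (10 ^+ L %| e (letter 1) - e (letter 0))%Z ->
  (forall l c, (l < m)%N -> (decodings l c <= bound l)%N) ->
  forall j l c c', (l < m)%N -> (j <= L)%N ->
  (10 ^+ j %| c' - c - repunit j)%Z ->
  (decodings l c + decodings l c' <= maxn (bound l) (2 * bound (l - j)))%N.
Proof.
move=> eT e01 IH; elim=> [|j IHj] l c c' lm jL hc.
  by rewrite subn0 mul2n -addnn leq_max leq_add ?orbT ?IH.
case: l lm hc => [|l] lm hc; first by rewrite sub0n bound0.
have [r [q [r10 cE]]] := decompose c.
have [r' [q' [r'10 cE']]] := decompose c'.
have rr : (10 %| r' - r - 1)%Z.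
  have h10 : (10 %| c' - c - repunit j.+1)%Z.
    by apply: dvdz_trans hc; rewrite exprS dvdz_mulr.
  by move: h10; rewrite cE cE' /=; lia.
have Bl : (decodings l.+1 c <= maxn (bound l.+1) (2 * bound (l.+1 - j.+1)))%N.
  by rewrite leq_max IH.
have Bl' : (decodings l.+1 c' <= maxn (bound l.+1) (2 * bound (l.+1 - j.+1)))%N.
  by rewrite leq_max IH.
move: Bl Bl'; rewrite cE cE' !(decodingsS _ _ eT) //.
have [r0|r0] := eqVneq r 0.
  have r1 : r' = 1 by lia.
  rewrite r1 /= => _ _; rewrite subSS.
  have lm' : (l < m)%N by exact: ltnW.
  apply: leq_trans (IHj l _ _ lm' (ltnW jL) _) _; last first.
    by rewrite geq_max leq_maxr andbT leq_max bound_mono.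
  have : (10 ^+ j.+1 %| 10 * (q' - q - repunit j))%Z.
    move: hc; rewrite cE cE' r0 r1 /=.
    by rewrite (_ : _ - _ = 10 * (q' - q - repunit j)) //; ring.
  rewrite exprS dvdz_mul2l //= => hq.
  rewrite (_ : _ - _ = q' - q - repunit j - (e (letter 1) - e (letter 0))); last by ring.
  by rewrite rpredB //; apply: dvdz_trans e01; rewrite dvdz_exp2l // ltnW.
have [r1|r1] := eqVneq r 1.
  have -> : r' = 2 by lia.
  by rewrite /= addn0.
have [r3|r3] := eqVneq r 3.
  have -> : r' = 4 by lia.
  by rewrite /= addn0.
have [r7|r7] := eqVneq r 7.
  have -> : r' = 8 by lia.
  by rewrite /= addn0.
by rewrite add0n.
Qed.

(* A word is decoded from its last letter, that is, from the lowest digit. A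
   digit is ambiguous only if it is 3 or 7; the carries of the two decodings
   then differ by a repunit, so that as long as both survive, they read the
   letters 0 and 1, respectively, and remain unambiguous for L steps. *)
Lemma decodings_le l c : (decodings l c <= 2 ^ ((l + L) %/ L.+1))%N.
Proof.
rewrite -/(bound l); have [e [eT e01 e24 e35]] := digits.
elim/ltn_ind: l c => -[|l] IH c; first by rewrite bound0.
have pair := decodings_pair eT e01 (fun k c kl => IH k kl c).
have [r [q [r10 ->]]] := decompose c; rewrite (decodingsS _ _ eT) //.
have B c' : (decodings l c' <= bound l.+1)%N.
  by apply: leq_trans (IH l _ _) _ => //; exact: bound_mono.
have B2 c1 c2 : (10 ^+ L %| c2 - c1 - repunit L)%Z ->
    (decodings l c1 + decodings l c2 <= bound l.+1)%N.
  move=> h; apply: leq_trans (pair L l c1 c2 _ _ h) _ => //.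
  by rewrite geq_max bound_mono //= bound_double.
case: ifP => _ //; case: ifP => _ //; case: ifP => _; last case: ifP => _ //.
- rewrite addnC; apply: B2.
  by rewrite (_ : _ - _ = e (letter 4) - e (letter 2) - repunit L) //; ring.
- rewrite addnC; apply: B2.
  by rewrite (_ : _ - _ = e (letter 5) - e (letter 3) - repunit L) //; ring.
Qed.

End Decimal.

(** * The multiplicity of the values of words *)

Section Value.
Context {A : finType} {R : realFieldType} (lam : R) (t : A -> R).

Definition word_value (w : seq A) : R := foldr (fun a x => t a + lam * x) 0 w.

Lemma word_value_cons a w : word_value (a :: w) = t a + lam * word_value w.
Proof. by []. Qed.

Lemma word_value_cat u v :
  word_value (u ++ v) = word_value u + lam ^+ size u * word_value v.
Proof.
elim: u => [|a u /= ->]; first by rewrite expr0 mul1r add0r.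
by rewrite exprS mulrDr addrA mulrA.
Qed.

Lemma word_value_rcons u a :
  word_value (rcons u a) = word_value u + lam ^+ size u * t a.
Proof. by rewrite -cats1 word_value_cat /= mulr0 addr0. Qed.

Definition nearby (C : R) (n : nat) (x : R) : nat :=
  (\sum_(w <- words n) (`|word_value w - x| <= C * lam ^+ n)%R)%N.

Lemma nearby_le_card C n x : (nearby C n x <= #|A| ^ n)%N.
Proof.
apply: (@leq_trans (\sum_(w <- @words A n) 1)%N).
  by rewrite leq_sum // => w _; exact: leq_b1.
elim: n => [|n IH]; first by rewrite big_words0.
by rewrite big_wordsS expnS -sum_nat_const leq_sum.
Qed.

Hypothesis lam01 : 0 < lam < 1.

Lemma word_value_bound B w : (forall a, 0 <= t a <= (1 - lam) * B) -> 0 <= B ->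
  0 <= word_value w <= B.
Proof.
move=> tB B0; elim: w => [|a w /andP[IH0 IH1]] /=; first by rewrite lexx.
have /andP[l0 l1] := lam01; have /andP[t0 t1] := tB a.
rewrite addr_ge0 ?mulr_ge0 ?(ltW l0) //=.
apply: (@le_trans _ _ ((1 - lam) * B + lam * B)); last by rewrite -mulrDl subrK mul1r.
by rewrite lerD // ler_pM2l.
Qed.

Context {B C : R}.
Hypothesis value_bound : forall w, `|word_value w| <= B.
Hypothesis BC : lam * C + B <= C.
Hypothesis C0 : 0 <= C.

(** If [w ++ u] is near [x] and [u] is nonempty, then by [BC] the prefix [w] is near [x] on the
    coarser scale, with the same [C]. Rescaling by [lam ^- n] turns the condition on [u] into
    nearness to another point. *)
Lemma nearby_add n k x M M' : (0 < k)%N ->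
  (forall y, nearby C n y <= M)%N -> (forall y, nearby C k y <= M')%N ->
  (nearby C (n + k) x <= M * M')%N.
Proof.
have /andP[l0 l1] := lam01.
case: k => // k _ hM hM'; rewrite /nearby big_words_cat.
apply: (@leq_trans (nearby C n x * M')); last by rewrite leq_mul2r hM orbT.
rewrite big_distrl /= big_seq [leqRHS]big_seq leq_sum // => w.
rewrite mem_words => /eqP sw.
have key u : `|word_value (w ++ u) - x| <= C * lam ^+ (n + k.+1) ->
    `|word_value w - x| <= C * lam ^+ n.
  move=> h; have -> : word_value w - x =
     (word_value (w ++ u) - x) - lam ^+ n * word_value u.
    by rewrite word_value_cat sw; ring.
  have ln : 0 <= lam ^+ n by rewrite exprn_ge0 // ltW.
  apply: le_trans (ler_normB _ _) _.
  rewrite normrM (ger0_norm ln).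
  apply: (@le_trans _ _ (lam ^+ n * (lam * C) + lam ^+ n * B)); last first.
    by rewrite -mulrDr mulrC ler_wpM2r.
  rewrite lerD ?ler_wpM2l //; apply: le_trans h _.
  rewrite (_ : C * _ = lam ^+ n * (lam * C) * lam ^+ k); last first.
    by rewrite exprD exprS; ring.
  by rewrite ler_piMr ?mulr_ge0 ?exprn_ile1 // ltW.
have [nw|] := boolP (`|word_value w - x| <= C * lam ^+ n).
  rewrite mul1n (leq_trans _ (hM' ((x - word_value w) / lam ^+ n))) //.
  rewrite leq_sum // => u _.
  suff -> : (`|word_value (w ++ u) - x| <= C * lam ^+ (n + k.+1)) =
     (`|word_value u - (x - word_value w) / lam ^+ n| <= C * lam ^+ k.+1) by [].
  have ln : 0 < lam ^+ n by rewrite exprn_gt0.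
  rewrite -[RHS](ler_pM2l ln) -{1}(gtr0_norm ln) -normrM exprD.
  congr (`| _ | <= _); last by rewrite mulrCA.
  by rewrite word_value_cat sw; field; rewrite expf_neq0 // gt_eqF.
move=> far; rewrite mul0n leqn0 big1 // => u _.
by case: (boolP (_ <= _)) => // /key h; rewrite h in far.
Qed.

(** The word is cut into blocks of length [l]; for the remainder, of length [n %% l], all words are
    counted. *)
Lemma nearby_le_pow l M n x : (0 < #|A|)%N -> (0 < l)%N -> (0 < M)%N -> (forall y, nearby C l y <= M)%N ->
  (nearby C n x <= #|A| ^ l * M ^ (n %/ l))%N.
Proof.
move=> A0 l0 M0 hM.
rewrite {1}(divn_eq n l); have := ltn_pmod n l0.
move: (n %% l)%N (n %/ l)%N => r q rl; elim: q x => [|q IH] x.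
  rewrite expn0 muln1 (leq_trans (nearby_le_card _ _ _)) //.
  by rewrite mul0n add0n leq_pexp2l // ltnW.
rewrite mulSn -addnA; have [k0|k0] := posnP (q * l + r).
  rewrite k0 addn0; apply: leq_trans (hM _) _.
  by rewrite -{1}[M]mul1n leq_mul ?expn_gt0 ?A0 // -{1}[M]expn1 leq_pexp2l.
apply: leq_trans (nearby_add x k0 hM (fun y => IH y)) _.
by rewrite mulnCA -expnS.
Qed.

End Value.

(** The errors of the letters add up along a geometric series of ratio at most 1/2, hence the factor
    2. *)
Lemma word_value_perturb {A : finType} {R : realFieldType} (lam : R)
    (t t' : A -> R) (e : R) w :
  0 < lam <= 2^-1 -> 0 <= e -> (forall a, `|t a - t' a| <= e) ->
  `|word_value lam t w - word_value lam t' w| <= 2 * e.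
Proof.
move=> /andP[l0 l2] e0 te.
elim: w => [|a w IH] /=; first by rewrite subrr normr0 mulr_ge0.
rewrite (_ : _ - _ = (t a - t' a) +
  lam * (word_value lam t w - word_value lam t' w)); last by ring.
rewrite (le_trans (ler_normD _ _)) // normrM (gtr0_norm l0).
have := te a; have : lam * `|word_value lam t w - word_value lam t' w| <= 2^-1 * (2 * e).
  by rewrite ler_pM // ltW.
lra.
Qed.

Lemma nearby_perturb {A : finType} {R : realFieldType} (lam : R)
    (t t' : A -> R) (e C : R) n x :
  0 < lam <= 2^-1 -> 0 <= e -> (forall a, `|t a - t' a| <= e) -> 2 * e <= lam ^+ n ->
  (nearby lam t C n x <= nearby lam t' (C + 1) n x)%N.
Proof.
move=> lam2 e0 te en; rewrite /nearby leq_sum // => w _.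
have := word_value_perturb w lam2 e0 te.
case: (boolP (_ <= C * _)) => // h h'; rewrite lt0b.
rewrite (_ : _ - _ = (word_value lam t w - x) -
  (word_value lam t w - word_value lam t' w)); last by ring.
by rewrite (le_trans (ler_normB _ _)) // mulrDl mul1r lerD // (le_trans h').
Qed.

(** * Multiplicity for rational translations *)

Section Rational.
Context {R : archiRealFieldType} (T : 'I_6 -> int) (D : int).
Hypothesis D_gt0 : 0 < D.
Let t (a : 'I_6) : R := (T a)%:~R / D%:~R.

(** [word_value] gives weight 1 to the first letter and [int_value] to the last one; the factor 10
    on the right avoids the exponent [size w - 1]. *)
Lemma word_value_int w :
  word_value 10^-1 t w * (D%:~R * 10 ^+ size w) = 10 * (int_value (T := T) w)%:~R.
Proof.
have D0 : D%:~R != 0 :> R by rewrite intr_eq0 gt_eqF.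
elim/last_ind: w => [|w a IH]; first by rewrite mul0r mulr0.
rewrite word_value_rcons size_rcons exprS mulrDl.
rewrite (_ : _ * (D%:~R * (10 * 10 ^+ size w)) =
  10 * (word_value 10^-1 t w * (D%:~R * 10 ^+ size w))); last by ring.
rewrite IH /int_value -cats1 foldl_cat /= -/(int_value w) rmorphD rmorphM /= mulrDr.
congr (_ + _); rewrite /t exprVn; field.
by rewrite D0 expf_neq0 ?pnatr_eq0.
Qed.

(* The values of the words of length l are multiples of 10 / (D 10^l), so only
   boundedly many of them are at distance O(10^-l) from x. *)
Lemma nearby_rational (C : R) (K L l : nat) x :
  0 <= C -> C * D%:~R <= K%:R ->
  (forall a : 'I_6, 10 ^+ L.+1 %| T a -
     nth 0 [:: 0; 1; 3; 7; 3 + 10 * repunit L; 7 + 10 * repunit L] a)%Z ->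
  (nearby 10^-1 t C l x <= K.+2 * 2 ^ ((l + L) %/ L.+1))%N.
Proof.
have index_of (a b : int) : a <= b -> b < a + K%:Z + 1 ->
    exists2 k : nat, (k < K.+2)%N & b = a + k%:Z.
  by move=> ab ba; exists `|b - a|%N; lia.
move=> C0 CK hT; have D0 : 0 < D%:~R :> R by rewrite ltr0z.
(* The integers of the words near [x] lie in a window of length [2 * C * D / 10], at most [K], whose
   lower end rounds down to [lo]. *)
pose lo : int := Num.floor ((x * 10 ^+ l - C) * D%:~R / 10).
apply: (@leq_trans (\sum_(w <- words l) \sum_(k < K.+2)
    (int_value (T := T) w == (lo + (k : nat)%:Z)%R))%N).
  rewrite /nearby [leqLHS]big_seq [leqRHS]big_seq leq_sum // => w; rewrite mem_words => /eqP sw.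
  case: (boolP (_ <= _)) => // h.
  have : exists2 k : nat, (k < K.+2)%N & int_value (T := T) w = lo + k%:Z.
    have E := word_value_int w; rewrite sw in E.
    set z := int_value w in E *; set v := word_value _ _ _ in E h.
    have p0 : 0 < 10 ^+ l :> R by rewrite exprn_gt0.
    have h' : `|v * 10 ^+ l - x * 10 ^+ l| <= C.
      rewrite -mulrBl normrM (gtr0_norm p0) -ler_pdivlMr //.
      by rewrite -exprVn.
    have zE : z%:~R = v * 10 ^+ l * D%:~R / 10 :> R.
      by rewrite -(mulrA v) (mulrC (10 ^+ l)) E; field.
    have /andP[lo1 lo2] := floor_itv ((x * 10 ^+ l - C) * D%:~R / 10).
    move: h'; rewrite ler_norml => /andP[h1 h2].
    have z1 : (x * 10 ^+ l - C) * D%:~R / 10 <= z%:~R.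
      by rewrite zE ler_pM2r ?invr_gt0 ?ltr0n // ler_pM2r //; lra.
    have z2 : z%:~R <= (x * 10 ^+ l - C) * D%:~R / 10 + K%:R.
      rewrite zE.
      have : (v * 10 ^+ l - (x * 10 ^+ l - C)) * D%:~R <= (2 * C) * D%:~R.
        by rewrite ler_pM2r //; lra.
      lra.
    have loz : lo <= z by rewrite -(ler_int R) (le_trans lo1).
    have zlo : z < lo + K%:Z + 1.
      rewrite -(ltr_int R) !rmorphD /= (le_lt_trans z2) //.
      by move: lo2; rewrite -/lo rmorphD /=; lra.
    exact: index_of.
  move=> [k kK e]; rewrite (bigD1 (Ordinal kK)) //= e eqxx.
  exact: leq_addr.
rewrite exchange_big /= -[K.+2 in leqRHS]card_ord -sum_nat_const leq_sum // => k _.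
apply: leq_trans (count_int_value _ _) _; exact: decodings_le.
Qed.

End Rational.

(** * Construction of the parameters *)

Section Construction.
Context {R : realType}.

Definition translations (tau sigma : R) (a : 'I_6) : R :=
  nth 0 [:: 0; 1; 3; 7; tau; sigma] a.

Definition value (tau sigma : R) (w : seq 'I_6) :=
  word_value 10^-1 (translations tau sigma) w.

Lemma value_cat tau sigma u v :
  value tau sigma (u ++ v) = value tau sigma u + 10^-1 ^+ size u * value tau sigma v.
Proof. exact: word_value_cat. Qed.

Lemma repunitSr k : repunit k.+1 = repunit k + 10 ^+ k.
Proof. by elim: k => //= k IH; rewrite exprS {1}IH; ring. Qed.

Lemma value_zeros tau sigma k w :
  value tau sigma (nseq k (inord 0) ++ w) = 10 ^- k * value tau sigma w.
Proof.
elim: k => [|k IH]; first by rewrite expr0 invr1 mul1r.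
rewrite -[nseq k.+1 _ ++ w]/(inord 0 :: (nseq k (inord 0) ++ w)).
rewrite /value word_value_cons -/(value _ _ _) IH /translations inordK //=.
by rewrite add0r exprS invfM mulrA.
Qed.

Lemma value_ones tau sigma k w : 10 ^+ k * value tau sigma (nseq k (inord 1) ++ w) =
  10 * (repunit k)%:~R + value tau sigma w.
Proof.
elim: k => [|k IH]; first by rewrite expr0 mul1r mulr0 add0r.
rewrite -[nseq k.+1 _ ++ w]/(inord 1 :: (nseq k (inord 1) ++ w)).
rewrite /value word_value_cons -/(value _ _ _) {1}/translations inordK //=.
set x := value _ _ _ in IH *.
rewrite (_ : _ * (1 + _) = 10 * 10 ^+ k + 10 ^+ k * x); last by rewrite exprS; field.
rewrite IH -/(repunit k.+1) repunitSr rmorphD /= rmorphXn /=. have -> : (10 : int)%:~R = 10 :> R by [].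
by rewrite /value; ring.
Qed.

(* [(n, D, U)] stands for the approximation U / D of a parameter, which is
   witnessed by an exact overlap of two words of length n + 1. *)
Definition approx : Type := (nat * int * int)%type.
Definition level (x : approx) := x.1.1.
Definition approx_value (x : approx) : R := x.2%:~R / x.1.2%:~R.

(** As an identity in [tau] and [sigma], this says that the difference of the two values is affine
    in the translation [c] alone. It vanishes at the approximation, and the other parameter can be
    moved freely. *)
Definition witnessed (c : nat) (x : approx) := 0 < x.1.2 /\
  exists u v : seq 'I_6, [/\ size u = (level x).+1, size v = (level x).+1, u <> v &
  forall tau sigma, 10 ^+ level x * (value tau sigma u - value tau sigma v) =
    x.1.2%:~R * translations tau sigma (inord c) - x.2%:~R].

(** The fraction is 10-adically close to [s + 10 * repunit L]. A denominator congruent to 1 keeps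
    the digits unchanged when two fractions are brought to a common denominator. *)
Definition normalized (s : int) (L : nat) (x : approx) :=
  (10 ^+ L.+1 %| x.1.2 - 1)%Z /\ (10 ^+ L.+1 %| x.2 - (s + 10 * repunit L))%Z.

(* If (u, v) witnesses x, then for large k the words u 0^k c and v 0^(k-L) 1^L b
   witness y, since a long block of zeros moves the parameter only slightly. *)
Lemma refine_approx (c b : nat) (s : int) (x : approx) (L : nat) (e : R) :
  (forall tau sigma, translations tau sigma (inord b) = s%:~R) ->
  0 <= s -> witnessed c x -> 0 <= approx_value x <= s%:~R + 10 -> (0 < L)%N -> 0 < e ->
  exists y, [/\ witnessed c y, normalized s L y, (level x < level y)%N &
    approx_value x <= approx_value y <= approx_value x + e].
Proof.
move=> tb s0 [D0 [u [v [su sv uv uvE]]]] /andP[x0 xs] L0 e0.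
pose N : int := s + 10 * repunit L.
have N0 : 0 <= N.
  by rewrite addr_ge0 // mulr_ge0 //; elim: (L) => //= k IH; lia.
(* [m] makes the real distance to [x] small, as it is at most [N / 10 ^+ m]. The further [L + 1] in
   [E] makes the old fraction vanish modulo [10 ^+ L.+1]. *)
have [m mN] : exists m : nat, N%:~R / e < m%:R :> R.
  by exists (Num.bound (N%:~R / e)); rewrite archi_boundP // divr_ge0 ?ler0z ?(ltW e0).
pose E := (m + L).+1.
have DE : 0 < 10 ^+ E * x.1.2 + 1 by rewrite addr_gt0 // mulr_gt0 // exprn_gt0.
(* After multiplication by [10 ^+ (level x + E)], the tails 0^(m+L) c and 0^m 1^L b contribute the
   translation of [c] minus [N]: hence [+ 1] in the denominator and [+ N] in the numerator. *)
pose y : approx := ((level x + E)%N, 10 ^+ E * x.1.2 + 1, 10 ^+ E * x.2 + N).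
have y1 : y.1.2%:~R = 10 ^+ E * x.1.2%:~R + 1 :> R.
  by rewrite intrD intrM rmorphXn.
have y2 : y.2%:~R = 10 ^+ E * x.2%:~R + N%:~R :> R.
  by rewrite intrD intrM rmorphXn.
have NE : N%:~R = 10 * (repunit L)%:~R + s%:~R :> R by rewrite addrC intrD intrM.
have ly : level y = (level x + E)%N by [].
exists y; split.
- split=> //; exists (u ++ (nseq (m + L) (inord 0) ++ [:: inord c])).
  exists (v ++ (nseq m (inord 0) ++ (nseq L (inord 1) ++ [:: inord b]))).
  rewrite ly; split.
  + by rewrite !size_cat size_nseq su /= /E; lia.
  + by rewrite !size_cat !size_nseq sv /= /E; lia.
  + by move=> /eqP; rewrite eqseq_cat ?su ?sv // => /andP[/eqP].
  move=> tau sigma; rewrite y1 y2 NE.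
  have := uvE tau sigma; have := value_ones tau sigma L [:: inord b].
  rewrite (value_cat _ _ u) (value_cat _ _ v) !value_zeros su sv.
  have value1 k : value tau sigma [:: inord k] = translations tau sigma (inord k).
    by rewrite /value word_value_cons /= mulr0 addr0.
  rewrite !value1 tb.
  set X := value _ _ (_ ++ _).
  set tc := translations _ _ _; set Vu := value _ _ u; set Vv := value _ _ v.
  rewrite /E; move: (level x) => n hX hV.
  have p0 k : 10 ^+ k != 0 :> R by rewrite expf_neq0 // pnatr_eq0.
  have -> : X = (10 * (repunit L)%:~R + s%:~R) / 10 ^+ L by rewrite -hX mulrC mulKf.
  have -> : Vu = Vv + (x.1.2%:~R * tc - x.2%:~R) / 10 ^+ n.
    by rewrite -hV mulrC mulKf // addrC subrK.
  by rewrite exprVn addnS !exprS !exprD; field; rewrite !p0.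
- split.
    by rewrite addrK dvdz_mulr // dvdz_exp2l // /E ltnS leq_addl.
  rewrite (_ : _ - _ = 10 ^+ E * x.2); last by rewrite /y /= /N; ring.
  by rewrite dvdz_mulr // dvdz_exp2l // /E ltnS leq_addl.
- by rewrite ly /E addnS ltnS leq_addr.
have D0' : 0 < x.1.2%:~R :> R by rewrite ltr0z.
have y0 : 0 < y.1.2%:~R :> R by rewrite ltr0z.
have diffE : approx_value y - approx_value x =
    (N%:~R - approx_value x) / y.1.2%:~R.
  rewrite /approx_value y2 y1; field.
  by rewrite -y1 !gt_eqF.
(* [L > 0] makes the repunit at least 1, so [x <= s + 10 <= N] and the approximations move to the
   right. *)
have xN : approx_value x <= N%:~R.
  rewrite (le_trans xs) // NE addrC lerD2r -[leLHS]mulr1 ler_pM2l //.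
  rewrite -(ler_int R) in N0 *.
  by case: (L) L0 => // k _; rewrite ler1z /=; elim: k => //= k; lia.
rewrite -subr_ge0 diffE divr_ge0 ?subr_ge0 ?(ltW y0) //=.
rewrite -lerBlDl diffE ler_pdivrMr // y1.
apply: (@le_trans _ _ N%:~R); first by rewrite gerBl.
rewrite mulrC -ler_pdivrMr // (le_trans (ltW mN)) //.
apply: (@le_trans _ _ (10 ^+ E)); last first.
  rewrite (@le_trans _ _ (10 ^+ E * x.1.2%:~R)) ?lerDl //.
  by rewrite ler_peMr ?exprn_ge0 // ler1z -gtz0_ge1.
rewrite -natrX ler_nat (leq_trans (ltnW (ltn_expl m (isT : 1 < 10)%N))) //.
by rewrite leq_pexp2l // /E -addnS leq_addr.
Qed.

(** Over the common denominator [D], still 1 modulo 10^(L+1), [nearby_rational] gives the bound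
    [K.+2 * 2 ^ i] at length [L.+1 * i], and [i = K.+2] makes it at most [4 ^ i]. The length being
    fixed, the bound extends to a neighbourhood of the parameters if [K] is chosen for [C + 1]
    instead of [C]. *)
Lemma nearby_approx (C : R) (L : nat) (x y : approx) : 0 <= C ->
  0 < x.1.2 -> 0 < y.1.2 -> normalized 3 L x -> normalized 7 L y ->
  exists j, (0 < j)%N /\ exists e, 0 < e /\ forall tau sigma,
    `|tau - approx_value x| <= e -> `|sigma - approx_value y| <= e ->
    forall z, (nearby 10^-1 (translations tau sigma) C (L.+1 * j) z <= 4 ^ j)%N.
Proof.
move=> C0 x0 y0 [x1 x2] [y1 y2].
pose D : int := x.1.2 * y.1.2.
pose T (a : 'I_6) : int :=
  nth 0 [:: 0; D; 3 * D; 7 * D; x.2 * y.1.2; y.2 * x.1.2] a.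
have D0 : 0 < D by rewrite mulr_gt0.
have DD : (10 ^+ L.+1 %| D - 1)%Z.
  rewrite (_ : D - 1 = (x.1.2 - 1) * y.1.2 + (y.1.2 - 1)); last by rewrite /D; ring.
  by rewrite rpredD // dvdz_mulr.
have T_mod (a : 'I_6) : (10 ^+ L.+1 %| T a -
     nth 0 [:: 0; 1; 3; 7; 3 + 10 * repunit L; 7 + 10 * repunit L] a)%Z.
  case: a => [[|[|[|[|[|[|//]]]]]] a6] /=; rewrite /T /=.
  - by rewrite subrr dvdz0.
  - by [].
  - by rewrite (_ : _ - _ = 3 * (D - 1)) ?dvdz_mull //; ring.
  - by rewrite (_ : _ - _ = 7 * (D - 1)) ?dvdz_mull //; ring.
  - rewrite (_ : _ - _ = (x.2 - (3 + 10 * repunit L)) * y.1.2 +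
      (y.1.2 - 1) * (3 + 10 * repunit L)); last by ring.
    by rewrite rpredD // dvdz_mulr.
  - rewrite (_ : _ - _ = (y.2 - (7 + 10 * repunit L)) * x.1.2 +
      (x.1.2 - 1) * (7 + 10 * repunit L)); last by ring.
    by rewrite rpredD // dvdz_mulr.
pose K := Num.bound ((C + 1) * D%:~R).
have CK : (C + 1) * D%:~R <= K%:R.
  by apply: ltW; apply: archi_boundP; rewrite mulr_ge0 ?addr_ge0 // ler0z ltW.
exists K.+2; split => //; pose l := (L.+1 * K.+2)%N.
exists (10^-1 ^+ l / 2); split; first by rewrite divr_gt0 // exprn_gt0 // invr_gt0.
move=> tau sigma htau hsigma z.
have l01 : 0 < (10^-1 : R) <= 2^-1 by apply/andP; split; lra.
have p0 : 0 < 10^-1 ^+ l :> R by rewrite exprn_gt0 // invr_gt0.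
have e2 : 2 * (10^-1 ^+ l / 2) <= 10^-1 ^+ l :> R by lra.
have e0 : 0 <= 10^-1 ^+ l / 2 :> R by rewrite divr_ge0 // ltW.
have d0 : D%:~R != 0 :> R by rewrite intr_eq0 gt_eqF.
have tT (a : 'I_6) : `|translations tau sigma a - (T a)%:~R / D%:~R| <= 10^-1 ^+ l / 2.
  case: a => [[|[|[|[|[|[|//]]]]]] a6] /=; rewrite /T /translations /=.
  - by rewrite mul0r subrr normr0.
  - by rewrite divff // subrr normr0.
  - by rewrite intrM mulfK // subrr normr0.
  - by rewrite intrM mulfK // subrr normr0.
  - rewrite /D !intrM -mulf_div divff ?mulr1 //.
    by rewrite intr_eq0 gt_eqF.
  - rewrite /D [x.1.2 * _]mulrC !intrM -mulf_div divff ?mulr1 //.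
    by rewrite intr_eq0 gt_eqF.
apply: leq_trans (nearby_perturb _ z l01 e0 tT e2) _.
apply: leq_trans (nearby_rational D0 l _ _ CK T_mod) _; first by rewrite addr_ge0.
have -> : ((l + L) %/ L.+1 = K.+2)%N by rewrite /l mulnC divnMDl // divn_small ?addn0.
rewrite (expnMn 2 2) leq_mul2r (ltnW (ltn_expl _ _)) ?orbT //.
Qed.

Lemma nested_intervals (a r : nat -> R) :
  (forall k, [/\ 0 <= r k, a k <= a k.+1 & a k.+1 + r k.+1 <= a k + r k]) ->
  exists x, forall k, a k <= x <= a k + r k.
Proof.
move=> H; have le_a k j : a k <= a (k + j)%N.
  elim: j => [|j IH]; first by rewrite addn0.
  by rewrite addnS (le_trans IH) //; have [] := H (k + j)%N.
have le_ar k j : a (k + j)%N + r (k + j)%N <= a k + r k.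
  elim: j => [|j IH]; first by rewrite addn0.
  by rewrite addnS (le_trans _ IH) //; have [] := H (k + j)%N.
have ub k : ubound (range a) (a k + r k).
  move=> _ [j _ <-]; have [kj|jk] := leqP k j.
    rewrite -(subnKC kj); apply: le_trans (le_ar k (j - k)%N).
    by rewrite lerDl; have [] := H (k + (j - k))%N.
  apply: le_trans (_ : a k <= _); first by rewrite -(subnKC (ltnW jk)).
  by rewrite lerDl; have [] := H k.
exists (sup (range a)) => k; apply/andP; split.
  by apply: ub_le_sup; [exists (a 0%N + r 0%N); exact: ub | exists k].
by apply: ge_sup; [exists (a 0%N), 0%N | exact: ub].
Qed.

Lemma positive_lower_bound (eps : nat -> R) m :
  (forall n, (1 <= n)%N -> 0 < eps n) ->
  exists2 e, 0 < e & forall i, (1 <= i <= m)%N -> e <= eps i.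
Proof.
move=> eps0; elim: m => [|m [e e0 IH]].
  by exists 1 => // i /andP[i1]; rewrite leqNgt i1.
exists (Num.min e (eps m.+1)); first by rewrite lt_min e0 eps0.
move=> i /andP[i1]; rewrite leq_eqVlt => /orP[/eqP ->|im].
  by rewrite ge_min lexx orbT.
by rewrite ge_min IH // i1 -ltnS.
Qed.


(** * The alternating refinement of the two parameters *)

Section Stages.
Variables (eps : nat -> R) (C : R).
Hypothesis eps_gt0 : forall n, (1 <= n)%N -> 0 < eps n.
Hypothesis C_ge0 : 0 <= C.

(** By submultiplicativity the multiplicity then grows at a rate of at most [ln 4 / k.+1] per
    letter. *)
Definition controlled (k : nat) (tau sigma : R) (j : nat) :=
  forall z, (nearby 10^-1 (translations tau sigma) C (k.+1 * j) z <= 4 ^ j)%N.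

(* The approximations of tau and sigma at a given stage, and the radii of the
   intervals to the right of them to which all later approximations belong. *)
Definition stage : Type := (approx * approx * R * R)%type.

(** By the third clause the overlap of [x] serves up to length [(level y).+1], where that of [y]
    becomes available, wherever [tau] ends up in its interval. The fourth one controls the
    multiplicity for all parameters that are still possible. *)
Definition valid (k : nat) (S : stage) : Prop :=
  let: (x, y, r, q) := S in
  [/\ [/\ witnessed 4 x, normalized 3 k x, 3 <= approx_value x, 0 < r &
          approx_value x + r <= 8],
      [/\ witnessed 5 y, normalized 7 k y, 7 <= approx_value y, 0 < q &
          approx_value y + q <= 8],
      (forall i, (1 <= i <= (level y).+1)%N -> x.1.2%:~R * r <= eps i) &
      exists2 j, (0 < j)%N & forall tau sigma,
        approx_value x <= tau <= approx_value x + r ->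
        approx_value y <= sigma <= approx_value y + q -> controlled k tau sigma j].

(** The last clause bridges the lengths up to [(level x').+1] by the overlap of the old [y]: even
    the right end of the new interval for [sigma] is close enough to [y]. *)
Definition refines (S S' : stage) : Prop :=
  let: (x, y, r, q) := S in let: (x', y', r', q') := S' in
  [/\ (level x < level x')%N,
      approx_value x <= approx_value x', approx_value x' + r' <= approx_value x + r,
      approx_value y <= approx_value y' /\ approx_value y' + q' <= approx_value y + q &
      forall i, (1 <= i <= (level x').+1)%N ->
        y.1.2%:~R * (approx_value y' + q' - approx_value y) <= eps i].

(** The third clause of [valid] is an upper bound for [r], and the fourth holds near the
    approximations by [nearby_approx], so shrinking the intervals achieves both. *)
Lemma valid_radii k x y r q :
  [/\ witnessed 4 x, normalized 3 k x, 3 <= approx_value x, 0 < r &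
          approx_value x + r <= 8] ->
  [/\ witnessed 5 y, normalized 7 k y, 7 <= approx_value y, 0 < q &
          approx_value y + q <= 8] ->
  exists r' q', [/\ r' <= r, q' <= q & valid k (x, y, r', q')].
Proof.
move=> [wx nx x3 r0 xr] [wy ny y7 q0 yq].
have Dx : 0 < x.1.2%:~R :> R by rewrite ltr0z; case: wx.
have [e e0 ee] := positive_lower_bound (level y).+1 eps_gt0.
have [j [j0 [d [d0 H]]]] : exists j, (0 < j)%N /\ exists d, 0 < d /\ forall tau sigma,
    `|tau - approx_value x| <= d -> `|sigma - approx_value y| <= d -> controlled k tau sigma j.
  by apply: nearby_approx => //; [case: wx | case: wy].
pose r' := Num.min r (Num.min d (e / x.1.2%:~R)); pose q' := Num.min q d.
have r'0 : 0 < r' by rewrite !lt_min r0 d0 divr_gt0.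
have q'0 : 0 < q' by rewrite lt_min q0 d0.
have r'r : r' <= r by rewrite ge_min lexx.
have r'd : r' <= d by rewrite !ge_min lexx orbT.
have r'e : r' <= e / x.1.2%:~R by rewrite !ge_min lexx !orbT.
have q'q : q' <= q by rewrite ge_min lexx.
have q'd : q' <= d by rewrite ge_min lexx orbT.
exists r', q'; split=> //; split.
- by split=> //; lra.
- by split=> //; lra.
- move=> i hi; apply: le_trans (ee i hi).
  by rewrite mulrC -ler_pdivlMr.
- exists j => // tau sigma /andP[t1 t2] /andP[s1 s2].
  by apply: H; rewrite ler_norml; apply/andP; split; lra.
Qed.

(** The order of the choices matters. First comes [x'], whose level determines how long the overlap
    of [y] has to serve; then [y'], close enough to [y] for this; the radii come last, when the
    level of [y'] is known. *)
Lemma valid_refines k S : valid k S -> exists S', valid k.+1 S' /\ refines S S'.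
Proof.
move: S => [[[x y] r] q] [[wx nx x3 r0 xr] [wy ny y7 q0 yq] hx _].
have r2 : 0 < r / 2 by lra.
have t2 tau sigma : translations tau sigma (inord 2) = 3%:~R.
  by rewrite /translations inordK.
have t3 tau sigma : translations tau sigma (inord 3) = 7%:~R.
  by rewrite /translations inordK.
have x13 : 0 <= approx_value x <= 3%:~R + 10 by apply/andP; split; lra.
have y17 : 0 <= approx_value y <= 7%:~R + 10 by apply/andP; split; lra.
have [x' [wx' nx' lx' /andP[xx' xx'r]]] :=
  refine_approx t2 isT wx x13 (isT : 0 < k.+1)%N r2.
have Dy : 0 < y.1.2%:~R :> R by rewrite ltr0z; case: wy.
have [e e0 ee] := positive_lower_bound (level x').+1 eps_gt0.
(* The step from [y] to [y'] and the new radius are at most [d] each, hence the halves. *)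
pose d := Num.min (q / 2) (e / y.1.2%:~R / 2).
have d0 : 0 < d by rewrite lt_min !divr_gt0.
have dq : d <= q / 2 by rewrite ge_min lexx.
have de : d <= e / y.1.2%:~R / 2 by rewrite ge_min lexx orbT.
have [y' [wy' ny' ly' /andP[yy' yy'd]]] :=
  refine_approx t3 isT wy y17 (isT : 0 < k.+1)%N d0.
have [||r' [q' [r'r q'd vS]]] := @valid_radii k.+1 x' y' (r / 2) d.
- by split=> //; lra.
- by split=> //; lra.
exists (x', y', r', q'); split=> //; split=> //; [lra|split=> //; lra|].
move=> i hi; apply: le_trans (ee i hi).
by rewrite mulrC -ler_pdivlMr //; lra.
Qed.

(** At [tau = 3] the letters 4 and 2 coincide, at [sigma = 7] the letters 5 and 3: overlaps of
    length 1. *)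
Lemma valid_start : exists S, valid 0 S /\ level S.1.1.1 = 0%N.
Proof.
have w4 : witnessed 4 (0%N, 1, 3).
  split=> //; exists [:: inord 4], [:: inord 2]; split=> //.
    by case=> /(congr1 val) /=; rewrite !inordK.
  move=> tau sigma; rewrite /value !word_value_cons /= !mulr0 !addr0.
  by rewrite /translations !inordK //= expr0 !mul1r.
have w5 : witnessed 5 (0%N, 1, 7).
  split=> //; exists [:: inord 5], [:: inord 3]; split=> //.
    by case=> /(congr1 val) /=; rewrite !inordK.
  move=> tau sigma; rewrite /value !word_value_cons /= !mulr0 !addr0.
  by rewrite /translations !inordK //= expr0 !mul1r.
have [||r [q [_ _ vS]]] := @valid_radii 0 (0%N, 1, 3) (0%N, 1, 7) 1 1.
- by split=> //; rewrite /approx_value /=; lra.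
- by split=> //; rewrite /approx_value /=; lra.
by exists ((0%N, 1, 3), (0%N, 1, 7), r, q).
Qed.

Lemma stages : exists S : nat -> stage,
  [/\ level (S 0%N).1.1.1 = 0%N, forall k, valid k (S k) & forall k, refines (S k) (S k.+1)].
Proof.
have [S0 [v0 l0]] := valid_start.
pose X := {p : nat * stage | valid p.1 p.2}.
pose next (p q : X) := (sval q).1 = (sval p).1.+1 /\ refines (sval p).2 (sval q).2.
have [p|f [f0 fS]] := @dependent_choice X next _ (exist _ (0%N, S0) v0).
  apply/cid; case: p => [[k S] /= vS]; have [S' [vS' SS']] := valid_refines vS.
  by exists (exist _ (k.+1, S') vS').
have fk k : (sval (f k)).1 = k.
  by elim: k => [|k IH]; [rewrite f0|have [-> _] := fS k; rewrite IH].
exists (fun k => (sval (f k)).2); split=> [|k|k]; first by rewrite f0.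
  by have := svalP (f k); rewrite fk.
by have [] := fS k.
Qed.

Lemma parameters : exists tau sigma : R,
  [/\ 0 <= tau <= 8, 0 <= sigma <= 8,
      forall k, exists2 j, (0 < j)%N & controlled k tau sigma j &
      forall n, (1 <= n)%N -> exists u v : seq 'I_6,
        [/\ size u = n, size v = n, u <> v &
        `|value tau sigma u - value tau sigma v| <= eps n]].
Proof.
have [S [l0 vS rS]] := stages.
pose x k := (S k).1.1.1; pose y k := (S k).1.1.2; pose r k := (S k).1.2; pose q k := (S k).2.
have SE k : S k = (x k, y k, r k, q k) by rewrite /x /y /r /q; case: (S k) => [[[]]].
have {}vS k : valid k (x k, y k, r k, q k) by rewrite -SE.
have {}rS k : refines (x k, y k, r k, q k) (x k.+1, y k.+1, r k.+1, q k.+1) by rewrite -!SE.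
have [|tau htau] := @nested_intervals (fun k => approx_value (x k)) r.
  by move=> k; have [[_ _ _ /ltW r0 _] _ _ _] := vS k; have [_ ? ? _ _] := rS k.
have [|sigma hsigma] := @nested_intervals (fun k => approx_value (y k)) q.
  by move=> k; have [_ [_ _ _ /ltW q0 _] _ _] := vS k; have [_ _ _ [? ?] _] := rS k.
exists tau, sigma; split.
- have [[_ _ ? _ ?] _ _ _] := vS 0%N; have /andP[? ?] := htau 0%N.
  by apply/andP; split; lra.
- have [_ [_ _ ? _ ?] _ _] := vS 0%N; have /andP[? ?] := hsigma 0%N.
  by apply/andP; split; lra.
- by move=> k; have [_ _ _ [j j0 H]] := vS k; exists j => //; apply: H.
move=> n n1.
(* An overlap of length [m.+1] is prolonged to length [n] by zeros on both sides, and the factor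
   [10 ^+ m >= 1] is given away. *)
have overlap c z (t : R) (m := level z) : witnessed c z -> (m.+1 <= n)%N ->
    translations tau sigma (inord c) = t ->
    0 <= t - approx_value z -> z.1.2%:~R * (t - approx_value z) <= eps n ->
    exists u v : seq 'I_6, [/\ size u = n, size v = n, u <> v &
        `|value tau sigma u - value tau sigma v| <= eps n].
  move=> [D0 [u [v [su sv uv E]]]] mn ct t0 te.
  exists (u ++ nseq (n - m.+1) (inord 0)), (v ++ nseq (n - m.+1) (inord 0)); split.
  + by rewrite size_cat size_nseq su subnKC.
  + by rewrite size_cat size_nseq sv subnKC.
  + by move=> /eqP; rewrite eqseq_cat ?su ?sv // => /andP[/eqP].
  rewrite !value_cat su sv opprD addrACA subrr addr0.
  have p1 : 1 <= 10 ^+ m :> R by rewrite exprn_ege1 // ler1n.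
  have D0' : 0 < z.1.2%:~R :> R by rewrite ltr0z.
  have := E tau sigma; rewrite ct -/m => {}E.
  have E' : 10 ^+ m * (value tau sigma u - value tau sigma v) = z.1.2%:~R * (t - approx_value z).
    by rewrite E mulrBr /approx_value [_ * (_ / _)]mulrCA divff ?mulr1 // gt_eqF.
  apply: le_trans te; rewrite -E' -{2}[value _ _ u - _]ger0_norm; last first.
    by rewrite -(pmulr_rge0 _ (lt_le_trans ltr01 p1)) E' mulr_ge0 // ltW.
  by rewrite ler_peMl.
(* The levels of the [x k] increase strictly from 0, so [n] falls between two consecutive ones.
   There the overlap of [x k] serves up to length [(level (y k)).+1], and that of [y k] beyond
   it. *)
have [k /andP[k1 k2]] : exists k, ((level (x k)).+1 <= n <= (level (x k.+1)).+1)%N.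
  have lx k : (k <= level (x k))%N.
    by elim: k => // k IH; have [+ _ _ _ _] := rS k; apply: leq_ltn_trans.
  have : (n <= (level (x n)).+1)%N by rewrite ltnW // ltnS.
  elim: {2}n => [|k IH]; first by rewrite [level _]l0 => h; exists 0%N; rewrite [level (x 0%N)]l0 n1 (leq_trans h).
  have [nk _|kn h] := leqP n (level (x k)).+1; first exact: IH.
  by exists k; rewrite h ltnW.
have /andP[t1 t2] := htau k; have /andP[s1 s2] := hsigma k.
have [[wx nx x3 r0 xr] [wy ny y7 q0 yq] hx _] := vS k.
have [nlt|ngt] := leqP n (level (y k)).+1.
  apply: (overlap 4 (x k) tau) => //.
  - by rewrite /translations inordK.
  - by rewrite subr_ge0.
  - have Dx : 0 < (x k).1.2%:~R :> R by rewrite ltr0z; case: wx.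
    by apply: le_trans (hx n _); rewrite ?n1 // ler_pM2l // lerBlDl.
apply: (overlap 5 (y k) sigma) => //; first exact: ltnW.
- by rewrite /translations inordK.
- by rewrite subr_ge0.
- have Dy : 0 < (y k).1.2%:~R :> R by rewrite ltr0z; case: wy.
  have [_ _ _ _ H] := rS k; apply: le_trans (H n _); rewrite ?n1 // ler_pM2l // lerB //.
  by have /andP[_] := hsigma k.+1.
Qed.

End Stages.
End Construction.

Local Open Scope classical_set_scope.

(** * Self-similar measures *)

Lemma geometric_small {R : realType} (r c e : R) : 0 < r < 1 -> 0 < c -> 0 < e ->
  exists N, forall n, (N <= n)%N -> r ^+ n * c <= e.
Proof.
move=> /andP[r0 r1] c0 e0.
have /cvgrPdist_lt/(_ (e / c)) : r ^+ n @[n --> \oo] --> (0 : R).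
  by apply: cvg_expr; rewrite gtr0_norm.
rewrite divr_gt0 // => /(_ isT) [N _ H]; exists N => n Nn.
have := H n Nn; rewrite /= sub0r normrN gtr0_norm ?exprn_gt0 // => h.
by rewrite -ler_pdivlMr // ltW.
Qed.

Lemma measurable_affine {R : realType} (a b : R) :
  measurable_fun setT ((fun x => a * x + b) : measurableTypeR R -> measurableTypeR R).
Proof.
apply: continuous_measurable_fun => x.
by apply: cvgD; [apply: cvgMl_tmp; exact: cvg_id | exact: cvg_cst].
Qed.

Section StationaryCdf.
Context {R : realType} {m : nat} (lam B : R) (t p : 'I_m.+1 -> R).
Hypothesis lam01 : 0 < lam < 1.
Hypothesis tB : forall j, 0 <= t j <= (1 - lam) * B.
Hypothesis p_ge0 : forall j, 0 <= p j.
Hypothesis p_sum : \sum_j p j = 1.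

Let l0 : 0 < lam. Proof. by case/andP: lam01. Qed.
Let l1 : lam < 1. Proof. by case/andP: lam01. Qed.
Let t0 j : 0 <= t j. Proof. by case/andP: (tB j). Qed.

(* The distribution function of [word_value lam t w] for a random word w of
   length n. It decreases with n because the translations are nonnegative, so
   its limit is an infimum and inherits right continuity. *)
Fixpoint cdf_iter (n : nat) (x : R) : R :=
  if n is k.+1 then \sum_j p j * cdf_iter k ((x - t j) / lam)
  else (0 <= x)%R%:R.

Lemma cdf_iter01 n x : 0 <= cdf_iter n x <= 1.
Proof.
elim: n x => [|n IH] x /=; first by rewrite ler0n lern1 leq_b1.
rewrite sumr_ge0 => [|j _]; last by rewrite mulr_ge0 //; case/andP: (IH ((x - t j) / lam)).
rewrite -p_sum ler_sum // => j _.
by rewrite ler_piMr //; case/andP: (IH ((x - t j) / lam)).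
Qed.

Lemma cdf_iter_nd n : nondecreasing (cdf_iter n).
Proof.
elim: n => [|n IH] x y xy /=.
  by rewrite ler_nat; case: (boolP (0 <= x)) => // /le_trans -> //; rewrite leq_b1.
rewrite ler_sum // => j _; rewrite ler_wpM2l // IH //.
by rewrite ler_pM2r ?invr_gt0 // lerD2r.
Qed.

Lemma cdf_iter_ni x : nonincreasing_seq (cdf_iter ^~ x).
Proof.
apply/nonincreasing_seqP => n; elim: n x => [|n IH] x /=.
  have [x0|x0] := leP 0 x.
    by have /andP[] := cdf_iter01 1 x.
  rewrite big1 // => j _; rewrite (_ : (0 <= _) = false) ?mulr0 //.
  by apply/negbTE; rewrite -ltNge pmulr_llt0 ?invr_gt0 // subr_lt0 (lt_le_trans x0).
by rewrite ler_sum // => j _; rewrite ler_wpM2l // IH.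
Qed.

(** A step function is even constant just to the right of each point. *)
Lemma cdf_iter_rc n x : \forall y \near x^'+, cdf_iter n y = cdf_iter n x.
Proof.
elim: n x => [|n IH] x /=.
  have [x0|x0] := leP 0 x.
    near=> y; suff -> : 0 <= y by [].
    by rewrite (le_trans x0) //; near: y; exact: nbhs_right_ge.
  near=> y; rewrite leNgt; suff -> : y < 0 by [].
  by near: y; exact: nbhs_right_lt.
suff H : \forall y \near x^'+, forall j,
    cdf_iter n ((y - t j) / lam) = cdf_iter n ((x - t j) / lam).
  by apply: filterS H => y H; apply: eq_bigr => j _; rewrite H.
apply: filter_forall => j; have [e /= e0 He] := IH ((x - t j) / lam).
exists (lam * e) => /=; first by rewrite mulr_gt0.
move=> y /= xy yx; apply: He => /=; last by rewrite ltr_pM2r ?invr_gt0 // ltrD2r.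
rewrite -mulrBl opprD addrACA subrr addr0 normrM (gtr0_norm (_ : 0 < lam^-1)) ?invr_gt0 //.
by rewrite ltr_pdivrMr // mulrC.
Unshelve. all: by end_near. Qed.

Lemma cdf_iter_lt0 n x : x < 0 -> cdf_iter n x = 0.
Proof.
move=> x0; apply/eqP; rewrite eq_le; have /andP[-> _] := cdf_iter01 n x; rewrite andbT.
by apply: le_trans (cdf_iter_ni x (leq0n n)) _; rewrite /= [0 <= x]leNgt x0.
Qed.

Lemma cdf_iter_ge n x : 0 <= B -> B <= x -> cdf_iter n x = 1.
Proof.
move=> B0; elim: n x => [|n IH] x Bx /=; first by rewrite (le_trans B0 Bx).
rewrite -p_sum; apply: eq_bigr => j _; rewrite IH ?mulr1 //.
rewrite ler_pdivlMr // lerBrDr; have /andP[_] := tB j; lra.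
Qed.

Definition stationary_cdf (x : R) : R := inf (range (cdf_iter ^~ x)).

Lemma cdf_iter_cvg x : cdf_iter ^~ x @ \oo --> stationary_cdf x.
Proof.
apply: nonincreasing_cvgn; first exact: cdf_iter_ni.
by exists 0 => _ [n _ <-]; case/andP: (cdf_iter01 n x).
Qed.

Lemma stationary_cdf_le n x : stationary_cdf x <= cdf_iter n x.
Proof.
apply: ge_inf; last by exists n.
by exists 0 => _ [k _ <-]; case/andP: (cdf_iter01 k x).
Qed.

Lemma stationary_cdf_nd : nondecreasing stationary_cdf.
Proof.
move=> x y xy; apply: lb_le_inf; first by exists (cdf_iter 0 y), 0%N.
move=> _ [n _ <-]; apply: le_trans (stationary_cdf_le n x) _; exact: cdf_iter_nd.
Qed.

Lemma stationary_cdf_rc : right_continuous stationary_cdf.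
Proof.
move=> x; apply/cvgrPdist_le => e e0.
have [_ [n _ <-] hn] : exists2 y, range (cdf_iter ^~ x) y & y < stationary_cdf x + e.
  apply: inf_adherent => //; split; first by exists (cdf_iter 0 x), 0%N.
  by exists 0 => _ [k _ <-]; case/andP: (cdf_iter01 k x).
near=> y; have xy : x <= y by near: y; exact: nbhs_right_ge.
rewrite ler0_norm ?subr_le0 ?stationary_cdf_nd // opprB lerBlDl.
apply: le_trans (stationary_cdf_le n y) _; apply: le_trans (ltW hn).
by rewrite le_eqVlt; apply/orP; left; apply/eqP; near: y; exact: cdf_iter_rc.
Unshelve. all: by end_near. Qed.

Lemma stationary_cdf_lt0 x : x < 0 -> stationary_cdf x = 0.
Proof.
move=> x0; rewrite -(cvg_lim _ (@cdf_iter_cvg x)) //.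
rewrite (_ : cdf_iter ^~ x = fun=> 0) ?lim_cst //.
by apply/funext => n; exact: cdf_iter_lt0.
Qed.

Lemma stationary_cdf_ge x : 0 <= B -> B <= x -> stationary_cdf x = 1.
Proof.
move=> B0 Bx; rewrite -(cvg_lim _ (@cdf_iter_cvg x)) //.
rewrite (_ : cdf_iter ^~ x = fun=> 1) ?lim_cst //.
by apply/funext => n; exact: cdf_iter_ge.
Qed.

Lemma stationary_cdf_eq x :
  stationary_cdf x = \sum_j p j * stationary_cdf ((x - t j) / lam).
Proof.
have H : cdf_iter n.+1 x @[n --> \oo] --> stationary_cdf x.
  by have := @cdf_iter_cvg x; rewrite -cvg_shiftS.
have H' : cdf_iter n.+1 x @[n --> \oo] -->
    \sum_j p j * stationary_cdf ((x - t j) / lam).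
  apply: (@cvg_big _ _ _ _ _ _ _ _ _ (fun j n => p j * cdf_iter n ((x - t j) / lam))).
    exact: add_continuous.
  by move=> j _; apply: cvgMl_tmp; exact: cdf_iter_cvg.
by rewrite -(cvg_lim _ H) // (cvg_lim _ H').
Qed.


Hypothesis B_ge0 : 0 <= B.

Let F := stationary_cdf.
Let F_nd : nondecreasing F. Proof. exact: stationary_cdf_nd. Qed.
Let F_rc : right_continuous F. Proof. exact: stationary_cdf_rc. Qed.
HB.instance Definition _ := isCumulative.Build R _ R F F_nd F_rc.

Let F_Ny : F @ -oo --> (0 : R).
Proof.
apply/cvgrPdist_le => e e0; near=> x.
have x0 : x < 0 by near: x; exact: nbhs_ninfty_lt.
by rewrite /F stationary_cdf_lt0 // subrr normr0 ltW.
Unshelve. all: by end_near. Qed.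

Let F_y : F @ +oo --> (1 : R).
Proof.
apply/cvgrPdist_le => e e0; near=> x.
have Bx : B <= x by near: x; apply: nbhs_pinfty_ge; rewrite num_real.
by rewrite /F stationary_cdf_ge // subrr normr0 ltW.
Unshelve. all: by end_near. Qed.

HB.instance Definition _ := isCumulativeBounded.Build R 0 1 F F_Ny F_y.

Let mu : probability (measurableTypeR R) R := lebesgue_stieltjes_measure F.

Let mu_oc a b : a <= b -> mu `]a, b]%classic = (F b - F a)%:E.
Proof.
move=> ab; rewrite /mu /= /lebesgue_stieltjes_measure /measure_extension /=.
rewrite measurable_mu_extE /=; last exact: is_ocitv.
by rewrite wlength_itv_bnd.
Qed.

(** The Stieltjes measure of the limit and the mixture of its images need to be compared on
    half-open intervals only, by uniqueness; there the equality is [stationary_cdf_eq]. *)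
Lemma stationary_measure : exists mu : probability (measurableTypeR R) R,
  forall A : set (measurableTypeR R), measurable A ->
    mu A = (\sum_j (p j)%:E * mu ((fun x : R => (lam * x + t j)%R) @^-1` A))%E.
Proof.
exists mu => A mA.
pose f j (x : measurableTypeR R) : measurableTypeR R := lam * x + t j.
have mf j : measurable_fun setT (f j).
  exact: measurable_affine.
pose nu' k : {measure set (measurableTypeR R) -> \bar R} :=
  mscale (NngNum (p_ge0 (inord k))) (pushforward mu (f (inord k))).
pose nu_ := nu' (fun k => mf (inord k)).
have nuE X : msum nu_ m.+1 X = (\sum_j (p j)%:E * mu (f j @^-1` X))%E.
  by apply: eq_bigr => j _; rewrite /nu_ /nu' /mscale /= inord_val.
rewrite -nuE; apply: lebesgue_stieltjes_measure_unique => // X [[a b] _ <-] /=.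
rewrite nuE; have [ba|ab] := ltP b a.
  rewrite set_itv_ge ?measure0 ?bnd_simp -?leNgt ?ltW // big1 // => j _.
  by rewrite preimage_set0 measure0 mule0.
rewrite [LHS](mu_oc ab).
have pre j : f j @^-1` `]a, b]%classic = `](a - t j) / lam, (b - t j) / lam]%classic.
  apply/seteqP; split => x /=; rewrite !in_itv /= /f.
    by rewrite ltr_pdivrMr // ler_pdivlMr // ltrBlDr lerBrDr [x * _]mulrC.
  by rewrite ltr_pdivrMr // ler_pdivlMr // ltrBlDr lerBrDr [x * _]mulrC.
under eq_bigr => j _.
  rewrite pre mu_oc; last by rewrite ler_pM2r ?invr_gt0 // lerD2r.
  rewrite -EFinM; over.
rewrite sumEFin; congr _%:E.
rewrite /F [in LHS]stationary_cdf_eq [X in _ - X]stationary_cdf_eq -sumrB.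
by apply: eq_bigr => j _; rewrite mulrBr.
Qed.

End StationaryCdf.

(** * Masses of sets in terms of words *)

Section SelfSimilar.
Context {R : realType} {m : nat} (Phi : ifs R m) (lam B : R).
Hypothesis lam01 : 0 < lam < 1.
Hypothesis ratioE : forall j, ifs_ratio Phi j = lam.
Hypothesis transB : forall j, 0 <= ifs_trans Phi j <= (1 - lam) * B.

Let val := word_value lam (ifs_trans Phi).

Lemma word_mapE w x : word_map Phi w x = lam ^+ size w * x + val w.
Proof.
elim: w x => [|j w IH] x; first by rewrite expr0 mul1r addr0.
rewrite -[LHS]/(ifs_map Phi j (word_map Phi w x)) IH /ifs_map ratioE.
by rewrite /val word_value_cons exprS; ring.
Qed.

Lemma trans_bound_ge0 : 0 <= B.
Proof.
have /andP[l0 l1] := lam01; have /andP[a b] := transB ord0.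
by rewrite -(pmulr_rge0 _ (_ : 0 < 1 - lam)) ?subr_gt0 // (le_trans a).
Qed.

Lemma val_bound w : 0 <= val w <= B.
Proof. by apply: word_value_bound => //; exact: trans_bound_ge0. Qed.

Lemma measurable_word_map w :
  measurable_fun setT (word_map Phi w : measurableTypeR R -> measurableTypeR R).
Proof.
rewrite (_ : word_map Phi w = fun x => lam ^+ size w * x + val w); last first.
  by apply/funext => x; exact: word_mapE.
exact: measurable_affine.
Qed.

Lemma measurable_preimage w (A : set (measurableTypeR R)) : measurable A ->
  measurable (word_map Phi w @^-1` A : set (measurableTypeR R)).
Proof. by move=> mA; rewrite -[X in measurable X]setTI; exact: measurable_word_map. Qed.

Variable p : 'I_m.+1 -> R.
Hypothesis p_pos : pos_prob_vector p.

Let p0 j : 0 < p j. Proof. by case: p_pos. Qed.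
Let p1 : \sum_j p j = 1. Proof. by case: p_pos. Qed.

Lemma self_similar_measureP : is_self_similar Phi p (self_similar_measure Phi p).
Proof.
suff [mu hmu] : exists mu, is_self_similar Phi p mu by exact: (xgetI _ hmu).
have [mu hmu] := stationary_measure lam01 transB (fun j => ltW (p0 j)) p1 trans_bound_ge0.
exists mu => A mA; rewrite hmu //; apply: eq_bigr => j _.
rewrite /pushforward (_ : ifs_map Phi j = fun x => lam * x + ifs_trans Phi j) //; apply/funext => x.
by rewrite /ifs_map ratioE.
Qed.

Definition word_prob (w : seq 'I_m.+1) : R := \prod_(j <- w) p j.

Lemma word_prob_gt0 w : 0 < word_prob w.
Proof. by rewrite /word_prob; elim/big_rec: _ => [|j x _ x0]; rewrite ?ltr01 ?mulr_gt0. Qed.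

Lemma word_prob_sum n : \sum_(w <- words n) word_prob w = 1.
Proof. by rewrite prod_words_sum p1 expr1n. Qed.

Variable mu : probability (measurableTypeR R) R.
Hypothesis mu_ss : is_self_similar Phi p mu.

Lemma self_similar_words n (A : set (measurableTypeR R)) : measurable A ->
  mu A = (\sum_(w <- words n) (word_prob w)%:E * mu (word_map Phi w @^-1` A))%E.
Proof.
elim: n A => [|n IH] A mA; first by rewrite big_words0 /word_prob big_nil mul1e.
rewrite mu_ss // big_wordsS; apply: eq_bigr => j _.
have mj : measurable (ifs_map Phi j @^-1` A : set (measurableTypeR R)).
  exact: (@measurable_preimage [:: j]).
rewrite /pushforward IH // ge0_sume_distrr; last first.
  by move=> w _; rewrite mule_ge0 // lee_fin ltW // word_prob_gt0.
apply: eq_bigr => w _; rewrite muleA -EFinM; congr (_%:E * _)%E.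
by rewrite /word_prob big_cons.
Qed.

Let E : set (measurableTypeR R) := `[-1, B + 1]%classic.

Let mE : measurable E. Proof. exact: measurable_itv. Qed.

(** Long words contract [[-k, k]] into [E], the unit neighbourhood of [[0, B]], so that [mu E] is at
    least the mass of [[-k, k]], for every [k]. *)
Lemma self_similar_support : mu E = 1%E.
Proof.
have /andP[l0 l1] := lam01.
apply/eqP; rewrite eq_le probability_le1 //=.
pose I k : set (measurableTypeR R) := `[- k%:R, k%:R]%classic.
have mI k : measurable (I k) by exact: measurable_itv.
have I1 : mu (I k) @[k --> \oo] --> mu (\bigcup_k I k).
  apply: nondecreasing_cvg_mu => //; first exact: bigcup_measurable.
  by move=> i j ij; apply/subsetPset/subset_itv; rewrite leBSide /= ?lerN2 ler_nat.
have IT : \bigcup_k I k = setT.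
  rewrite -subTset => x _; exists (Num.bound `|x|) => //=.
  have : `|x| <= (Num.bound `|x|)%:R by rewrite ltW // archi_boundP.
  by rewrite /I /= in_itv /= ler_norml.
rewrite IT probability_setT in I1.
suff IE k : (mu (I k) <= mu E)%E.
  by rewrite -(cvg_lim _ I1) //; apply: lime_le; [apply/cvg_ex; eexists; exact: I1|exact: nearW].
have [n hn] : exists n, lam ^+ n * k%:R <= 1.
  have [n Hn] := geometric_small lam01 (ltr0Sn R k) ltr01; exists n.
  by apply: le_trans (Hn n (leqnn n)); rewrite ler_pM2l ?exprn_gt0 // ler_nat.
rewrite (self_similar_words n mE) -[leLHS]mul1e -(word_prob_sum n) -sumEFin.
rewrite ge0_sume_distrl; last by move=> w _; rewrite lee_fin ltW // word_prob_gt0.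
rewrite big_seq [leRHS]big_seq; apply: lee_sum => w; rewrite mem_words => /eqP sw.
rewrite lee_wpmul2l ?lee_fin ?(ltW (word_prob_gt0 _)) // le_measure ?inE //.
  exact: measurable_preimage.
move=> x; rewrite /I /E /= !in_itv /= word_mapE sw => /andP[x1 x2].
have /andP[v0 vB] := val_bound w; have p0n : 0 <= lam ^+ n by rewrite exprn_ge0 // ltW.
have := ler_wpM2l p0n x1; have := ler_wpM2l p0n x2.
by move=> ? ?; apply/andP; split; lra.
Qed.

Lemma self_similar_ge w (A : set (measurableTypeR R)) : measurable A ->
  E `<=` word_map Phi w @^-1` A -> ((word_prob w)%:E <= mu A)%E.
Proof.
move=> mA EA; rewrite (self_similar_words (size w) mA).
have mw : (w \in words (size w)) by rewrite mem_words.
rewrite (bigD1_seq w) //=; last exact: uniq_words.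
apply: (@le_trans _ _ ((word_prob w)%:E * mu (word_map Phi w @^-1` A))%E).
  rewrite -{1}[(word_prob w)%:E]mule1 lee_wpmul2l ?lee_fin ?(ltW (word_prob_gt0 _)) //.
  rewrite -self_similar_support le_measure ?inE //; exact: measurable_preimage.
rewrite leeDl // sume_ge0 // => u _.
by rewrite mule_ge0 // lee_fin ltW // word_prob_gt0.
Qed.

(** For a word outside [Q] the preimage of [A] misses [E] and is thus a null set. *)
Lemma self_similar_le n (Q : pred (seq 'I_m.+1)) (A : set (measurableTypeR R)) :
  measurable A ->
  (forall w, size w = n -> ~~ Q w -> forall x, -1 <= x <= B + 1 -> ~ A (lam ^+ n * x + val w)) ->
  (mu A <= (\sum_(w <- words n | Q w) word_prob w)%:E)%E.
Proof.
move=> mA H; rewrite (self_similar_words n mA) -sumEFin [leRHS]big_mkcond /=.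
rewrite big_seq [leRHS]big_seq; apply: lee_sum => w; rewrite mem_words => /eqP sw.
have mw := measurable_preimage w mA.
case: ifPn => Qw.
  rewrite -[leRHS]mule1 lee_wpmul2l ?lee_fin ?(ltW (word_prob_gt0 _)) //.
  exact: probability_le1.
suff -> : mu (word_map Phi w @^-1` A) = 0%E by rewrite mule0.
apply/eqP; rewrite eq_le measure_ge0 andbT.
have <- : mu (~` E) = 0%E by rewrite probability_setC // self_similar_support subee.
apply: le_measure; rewrite ?inE //; first exact: measurableC.
move=> x Ax; rewrite /E /= in_itv /= => xE.
by apply: (H w sw Qw x xE); rewrite -sw -word_mapE.
Qed.

End SelfSimilar.

(** * Large deviations and Borel-Cantelli *)

(** From [expR y <= (1 - y)^-1], because [(1 - y) * (1 + y + 2 * y ^+ 2) = 1 + y ^+ 2 * (1 - 2 *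
    y)]. *)
Lemma expR_le_quadratic {R : realType} (y : R) : `|y| <= 2^-1 -> expR y <= 1 + y + 2 * y ^+ 2.
Proof.
rewrite ler_norml => /andP[y1 y2].
have h : 0 < 1 - y by lra.
have e1 : 1 - y <= expR (- y) by rewrite -[1 - y]/(1 + - y); exact: expR_ge1Dx.
have e2 : expR y <= (1 - y)^-1.
  by rewrite -[expR y]invrK -expRN lef_pV2 ?posrE ?expR_gt0.
apply: le_trans e2 _; rewrite -[leLHS]mul1r ler_pdivrMr // expr2; nra.
Qed.

(** The exponential moment of [Y] dominates the deviation and factors over the letters by
    [prod_words_sum]. As [Y] has mean [- e], the moment is below 1 for a small [th]. *)
Lemma chernoff_words {R : realType} {A : finType} (p X : A -> R) (e : R) :
  (forall a, 0 <= p a) -> \sum_a p a = 1 -> \sum_a p a * X a = 0 -> 0 < e ->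
  exists2 r, 0 <= r < 1 & forall n,
    \sum_(w <- words n | n%:R * e < \sum_(a <- w) X a) \prod_(a <- w) p a <= r ^+ n.
Proof.
move=> p0 p1 pX e0.
pose Y a := X a - e; pose M := 1 + \sum_a Y a ^+ 2.
have M1 : 1 <= M by rewrite lerDl sumr_ge0 // => a _; exact: sqr_ge0.
have YM a : Y a ^+ 2 <= M - 1.
  by rewrite /M addrC addKr (bigD1 a) //= lerDl sumr_ge0 // => b _; exact: sqr_ge0.
have YM' a : `|Y a| <= M by have := YM a; rewrite ler_norml => ?; apply/andP; split; nra.
have p_le1 a : p a <= 1 by rewrite -p1 (bigD1 a) //= lerDl sumr_ge0.
(* The first bound admits [expR_le_quadratic]; the second keeps the quadratic term within half of
   the linear gain [th * e]. *)
pose th := Num.min ((2 * M)^-1) (e / (4 * M)).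
have M0 : 0 < M by lra.
have th0 : 0 < th by rewrite lt_min invr_gt0 divr_gt0 ?mulr_gt0.
have th1 : th * M <= 2^-1.
  by rewrite -ler_pdivlMr // -invfM ge_min lexx.
have th2 : th * M <= e / 4.
  by rewrite -ler_pdivlMr // -mulrA -invfM ge_min lexx orbT.
have key : \sum_a p a * expR (th * Y a) <= 1 - th * e / 2.
  have step a : p a * expR (th * Y a) <= p a * (1 + th * Y a) + 2 * th ^+ 2 * (p a * Y a ^+ 2).
    have : expR (th * Y a) <= 1 + th * Y a + 2 * (th * Y a) ^+ 2.
      apply: expR_le_quadratic; rewrite normrM (gtr0_norm th0).
      by apply: le_trans th1; rewrite ler_pM2l.
    by move=> /(ler_wpM2l (p0 a)) h; apply: le_trans h _; rewrite exprMn; lra.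
  apply: le_trans (ler_sum _ (fun a _ => step a)) _.
  rewrite big_split /= -mulr_sumr.
  have -> : \sum_a p a * (1 + th * Y a) = 1 - th * e.
    under eq_bigr do rewrite /Y mulrDr mulr1 mulrCA mulrBr.
    rewrite big_split /= p1 -mulr_sumr sumrB pX -mulr_suml p1; lra.
  have : \sum_a p a * Y a ^+ 2 <= M.
    rewrite /M -[leLHS]add0r lerD // ler_sum // => a _.
    by rewrite ler_piMl // sqr_ge0.
  set S := \sum_a _ => SM.
  have : th ^+ 2 * S <= th * (e / 4).
    rewrite expr2 -mulrA ler_pM2l // (le_trans _ th2) //.
    by rewrite ler_pM2l.
  nra.
pose r := \sum_a p a * expR (th * Y a).
have r0 : 0 <= r by apply: sumr_ge0 => a _; rewrite mulr_ge0 ?expR_ge0.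
have te : 0 < th * e by rewrite mulr_gt0.
exists (1 - th * e / 2); first by apply/andP; split; [apply: le_trans r0 key | lra].
move=> n; apply: (@le_trans _ _ (r ^+ n)); last first.
  by rewrite lerXn2r // nnegrE (le_trans r0).
rewrite /r -prod_words_sum big_mkcond /= big_seq [leRHS]big_seq ler_sum // => w.
rewrite mem_words => /eqP sw.
have w0 : 0 <= \prod_(a <- w) p a by apply: prodr_ge0 => a _; exact: p0.
rewrite big_split /=.
have -> : \prod_(a <- w) expR (th * Y a) = expR (th * (\sum_(a <- w) X a - n%:R * e)).
  rewrite -sw; elim: (w) => [|a u IH]; first by rewrite !big_nil /= mul0r subrr mulr0 expR0.
  rewrite !big_cons IH -expRD /Y /= -natr1; congr expR; ring.
case: ifPn => h; last by rewrite mulr_ge0 // expR_ge0.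
rewrite ler_peMr // -[leLHS]expR0 ler_expR mulr_ge0 ?subr_ge0 //; exact: ltW.
Qed.

Lemma borel_cantelli_geometric {d} {T : measurableType d} {R : realType}
    (mu : {measure set T -> \bar R}) (F : nat -> set T) (K r : R) :
  (forall n, measurable (F n)) -> 0 <= r < 1 -> 0 <= K ->
  (forall n, (mu (F n) <= (K * r ^+ n)%:E)%E) ->
  {ae mu, forall x, \forall n \near \oo, ~ F n x}.
Proof.
move=> mF /andP[r0 r1] K0 muF.
have H : mu (lim_sup_set F) = 0%E.
  apply: lim_sup_set_cvg0 => //.
  apply: (@le_lt_trans _ _ (K / (1 - r))%:E); last by rewrite ltry.
  apply: lime_le; first exact: is_cvg_nneseries.
  apply: nearW => n; apply: (@le_trans _ _ (\sum_(0 <= i < n) (K * r ^+ i)%:E)%E).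
    exact: lee_sum.
  rewrite sumEFin lee_fin -mulr_sumr ler_wpM2l //.
  rewrite -[leRHS]mul1r ler_pdivlMr ?subr_gt0 // big_mkord.
  have -> : (\sum_(i < n) r ^+ i) * (1 - r) = 1 - r ^+ n.
    by rewrite mulrC -[LHS]opprK -mulNr opprB -subrX1 opprB.
  by rewrite gerBl exprn_ge0.
exists (lim_sup_set F); split => //.
  by apply: bigcap_measurable => // n _; apply: bigcup_measurable.
move=> x /= hx n _; apply: contrapT => h; apply: hx; exists n => // k /= nk Fk.
by apply: h; exists k.
Qed.

(** * From geometric scales to all radii *)

Section LogRatio.
Context {R : realType} (f : R -> R) (h c lam : R).
Hypothesis lam01 : 0 < lam < 1.
Hypothesis c0 : 0 < c.
Hypothesis f_nd : forall x y, 0 < x -> x <= y -> f x <= f y.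
Hypothesis f_ge : forall e, 0 < e ->
  \forall n \near \oo, expR (- (n%:R * (h + e))) <= f (c * lam ^+ n).
Hypothesis f_le : forall e, 0 < e ->
  \forall n \near \oo, f (lam ^+ n) <= expR (- (n%:R * (h - e))).

(** A radius [d] between [lam ^+ n.+1] and [lam ^+ n] exceeds [c * lam ^+ (n + k.+1)]. Hence
    [- ln (f d)] is [n * h] up to [n * e] and a bounded amount, which is negligible against
    [- ln d]. *)
Lemma log_ratio_cvg : (log2 (f d) / log2 d) @[d --> (0 : R)^'+] --> h / - ln lam.
Proof.
have /andP[l0 l1] := lam01.
have L0 : 0 < - ln lam by rewrite oppr_gt0 ln_lt0 // l0.
set L := - ln lam in L0 *.
have lamE n : lam ^+ n = expR (- (n%:R * L)).
  by rewrite /L mulrN opprK expRM_natl lnK.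
have [k ck] : exists k, c * lam ^+ k <= 1.
  have [k Hk] := geometric_small lam01 c0 ltr01; exists k.
  by rewrite mulrC Hk.
apply/cvgrPdist_le => eta eta0.
pose e := eta * L / 2; have e0 : 0 < e by rewrite divr_gt0 // mulr_gt0.
have [N1 _ H1] := f_ge e0; have [N2 _ H2] := f_le e0.
(* The first summand makes the bounded error at most [s * (eta / 2)], the second forces
   [n >= N1 + N2]. *)
pose S := (k.+1%:R * (`|h| + e)) / (eta / 2) + (N1 + N2).+1%:R * L + 1.
near=> d.
have d0 : 0 < d by near: d; exact: nbhs_right_gt.
have dS : d < expR (- S) by near: d; apply: nbhs_right_lt; exact: expR_gt0.
pose s := - ln d.
have dE : d = expR (- s) by rewrite /s opprK lnK.
have sS : S < s by rewrite -ltrN2 -ltr_expR -dE.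
have t1 : 0 <= (k.+1%:R * (`|h| + e)) / (eta / 2).
  apply: divr_ge0; last by rewrite ltW // divr_gt0.
  by rewrite mulr_ge0 // addr_ge0 // ltW.
have s0 : 0 < s.
  apply: lt_trans sS; rewrite /S; apply: ltr_wpDl => //.
  by rewrite addr_ge0 // mulr_ge0 // ltW.
pose n := Num.truncn (s / L).
have /andP[n1 n2] : n%:R <= s / L < n.+1%:R.
  by apply: truncn_itv; rewrite divr_ge0 // ltW.
rewrite ler_pdivlMr // in n1; rewrite ltr_pdivrMr // in n2.
have nN : (N1 + N2 <= n)%N.
  rewrite -ltnS -(ltr_nat R) -(ltr_pM2r L0); apply: le_lt_trans n2.
  apply: le_trans (ltW sS); rewrite /S -natr1 mulrDl mul1r; lra.
have fu : f d <= expR (- (n%:R * (h - e))).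
  apply: le_trans (H2 n _); last by rewrite /= (leq_trans _ nN) // leq_addl.
  by apply: f_nd => //; rewrite lamE dE ler_expR lerN2.
have fl : expR (- ((n + k.+1)%:R * (h + e))) <= f d.
  apply: le_trans (H1 (n + k.+1)%N _) _.
    by rewrite /= (leq_trans _ (leq_addr _ _)) // (leq_trans _ nN) // leq_addr.
  apply: f_nd; first by rewrite mulr_gt0 // exprn_gt0.
  rewrite addnS -addSn addnC exprD mulrA.
  apply: (@le_trans _ _ (lam ^+ n.+1)).
    by rewrite ler_piMl // exprn_ge0 // ltW.
  by rewrite lamE dE ler_expR lerN2 ltW.
have f0 : 0 < f d by apply: lt_le_trans fl; exact: expR_gt0.
have -> : log2 (f d) / log2 d = (- ln (f d)) / s.
  rewrite /log2 /s -mulf_div divff ?mulr1 ?invrN ?mulrNN //.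
  by rewrite invr_eq0 gt_eqF // ln_gt0 // ltr1n.
set F := - ln (f d).
have Fu : n%:R * (h - e) <= F by rewrite lerNr -ler_expR lnK.
have Fl : F <= (n + k.+1)%:R * (h + e) by rewrite lerNl -ler_expR lnK.
have hL : h / L * s = h * (s / L) by rewrite -mulrA [_ * s]mulrC.
set q := s / L in n1 n2 hL.
have qs : q * L = s by rewrite /q divfK // gt_eqF.
have sbig : k.+1%:R * (`|h| + e) <= s * (eta / 2).
  rewrite -ler_pdivrMr ?divr_gt0 //; apply: le_trans (ltW sS).
  by rewrite /S -addrA lerDl addr_ge0 // mulr_ge0 // ltW.
have nq : n%:R <= q by rewrite -(ler_pM2r L0) qs.
have qn : q < n.+1%:R by rewrite -(ltr_pM2r L0) qs.
have eq : e * q = s * (eta / 2) by rewrite /e -qs; field.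
have h1 : h <= `|h| := ler_norm h.
have h2 : - h <= `|h| by rewrite -normrN ler_norm.
have h0 := normr_ge0 h.
have k0 : 0 <= k%:R :> R by rewrite ler0n.
rewrite natrD in Fl; rewrite -natr1 in sbig Fl; rewrite -natr1 in qn.
have -> : h / L - F / s = (h * q - F) / s.
  by rewrite mulrBl -hL mulfK // gt_eqF.
rewrite normrM normfV (gtr0_norm s0) ler_pdivrMr // ler_norml.
move: h1 h2 h0 k0 Fl Fu sbig qn nq eq e0 => {}h1 {}h2 h0 k0 {}Fl {}Fu {}sbig {}qn {}nq eq e0'.
apply/andP; split; nra.
Unshelve. all: by end_near. Qed.


End LogRatio.

(** * Local dimension *)

Section TypicalWords.
Context {R : realType} {m : nat} (p : 'I_m.+1 -> R).
Hypothesis p_pos : pos_prob_vector p.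
Let p0 j : 0 < p j. Proof. by case: p_pos. Qed.
Let p1 : \sum_j p j = 1. Proof. by case: p_pos. Qed.

(** With natural logarithms; the base cancels in the quotient by [- ln lam]. *)
Definition nat_entropy : R := - \sum_j p j * ln (p j).
Let h := nat_entropy.

Lemma word_probE w : word_prob p w = expR (\sum_(j <- w) ln (p j)).
Proof.
elim: w => [|j w IH]; first by rewrite /word_prob !big_nil expR0.
by rewrite /word_prob !big_cons expRD lnK ?posrE // -IH.
Qed.

Lemma light_words e : 0 < e -> exists2 r, 0 <= r < 1 & forall n,
  \sum_(w <- words n | word_prob p w < expR (- (n%:R * (h + e)))) word_prob p w <= r ^+ n.
Proof.
move=> e0.
have [||||r r01 H] := @chernoff_words R _ p (fun j => - ln (p j) - h) e => //.
- by move=> a; exact: ltW.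
- under eq_bigr do rewrite mulrBr mulrN.
  by rewrite sumrB sumrN -mulr_suml p1 mul1r /h /nat_entropy opprK addNr.
exists r => // n; apply: le_trans (H n).
rewrite big_mkcond [leRHS]big_mkcond /= big_seq [leRHS]big_seq ler_sum // => w.
rewrite mem_words => /eqP sw.
suff -> : (word_prob p w < expR (- (n%:R * (h + e)))) =
  (n%:R * e < \sum_(a <- w) (- ln (p a) - h)) by [].
rewrite word_probE ltr_expR.
have -> : \sum_(a <- w) (- ln (p a) - h) = - \sum_(a <- w) ln (p a) - n%:R * h.
  by rewrite sumrB sumrN big_const_seq count_predT sw iter_addr_0 mulr_natl.
by apply/idP/idP => ?; lra.
Qed.

Lemma heavy_words e : 0 < e -> exists2 r, 0 <= r < 1 & forall n,
  \sum_(w <- words n | expR (- (n%:R * (h - e))) < word_prob p w) word_prob p w <= r ^+ n.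
Proof.
move=> e0.
have [||||r r01 H] := @chernoff_words R _ p (fun j => ln (p j) + h) e => //.
- by move=> a; exact: ltW.
- under eq_bigr do rewrite mulrDr.
  by rewrite big_split /= -mulr_suml p1 mul1r /h /nat_entropy subrr.
exists r => // n; apply: le_trans (H n).
rewrite big_mkcond [leRHS]big_mkcond /= big_seq [leRHS]big_seq ler_sum // => w.
rewrite mem_words => /eqP sw.
suff -> : (expR (- (n%:R * (h - e))) < word_prob p w) =
  (n%:R * e < \sum_(a <- w) (ln (p a) + h)) by [].
rewrite word_probE ltr_expR.
have -> : \sum_(a <- w) (ln (p a) + h) = \sum_(a <- w) ln (p a) + n%:R * h.
  by rewrite big_split /= big_const_seq count_predT sw iter_addr_0 mulr_natl.
by apply/idP/idP => ?; lra.
Qed.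

Lemma card_heavy_words c n :
  (\sum_(w <- words n) (expR (- c) < word_prob p w)%R)%:R <= expR c.
Proof.
rewrite -[leRHS]mulr1 -[X in _ * X](word_prob_sum p_pos n) mulr_sumr natr_sum ler_sum // => w _.
case: (boolP (expR (- c) < _)) => [h'|_]; last by rewrite mulr_ge0 ?expR_ge0 // ltW // word_prob_gt0.
by rewrite -(ler_pM2l (expR_gt0 (- c))) mulrA -expRD addNr expR0 mul1r mulr1 ltW.
Qed.

End TypicalWords.

Section LocalDimension.
Context {R : realType} {m : nat} (Phi : ifs R m) (lam B : R).
Hypothesis lam01 : 0 < lam < 1.
Hypothesis ratioE : forall j, ifs_ratio Phi j = lam.
Hypothesis transB : forall j, 0 <= ifs_trans Phi j <= (1 - lam) * B.
Variable p : 'I_m.+1 -> R.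
Hypothesis p_pos : pos_prob_vector p.
Variable mu : probability (measurableTypeR R) R.
Hypothesis mu_ss : is_self_similar Phi p mu.

Let val := word_value lam (ifs_trans Phi).
Let h := nat_entropy p.
Let l0 : 0 < lam. Proof. by case/andP: lam01. Qed.
Let ln0 n : 0 < lam ^+ n. Proof. exact: exprn_gt0. Qed.
Let B0 : 0 <= B. Proof. exact: trans_bound_ge0 lam01 transB. Qed.

Definition ball_mass (x d : R) : R := fine (mu `]x - d, x + d[%classic).

Let ball_massE x d : mu `]x - d, x + d[%classic = (ball_mass x d)%:E.
Proof. by rewrite /ball_mass fineK // fin_num_measure. Qed.

Lemma ball_mass_nd x d d' : d <= d' -> ball_mass x d <= ball_mass x d'.
Proof.
move=> dd; rewrite -lee_fin -!ball_massE le_measure ?inE //.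
by apply: subset_itv; rewrite bnd_simp; lra.
Qed.

Let tube (W : pred (seq 'I_m.+1)) (a b : R) n : set (measurableTypeR R) :=
  \bigcup_(w in [set` [seq w <- words n | W w]])
    `[val w + a * lam ^+ n, val w + b * lam ^+ n]%classic.

Let measurable_tube W a b n : measurable (tube W a b n).
Proof. by rewrite /tube bigcup_seq; apply: bigsetU_measurable => w _; exact: measurable_itv. Qed.

Let tubeP (W : pred (seq 'I_m.+1)) (a b : R) (n : nat) (x : R) : tube W a b n x <->
  exists2 w, size w = n /\ W w & val w + a * lam ^+ n <= x <= val w + b * lam ^+ n.
Proof.
split=> [[w /= + wx]|[w [sw Ww] wx]].
  rewrite mem_filter mem_words => /andP[Ww /eqP sw]; exists w => //.
exists w => /=; first by rewrite mem_filter Ww mem_words sw eqxx.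
by rewrite /= in_itv.
Qed.

(** Up to an exponentially small mass, [x] lies in the image of [[-1, B + 1]] under a word that is
    not light. This image has length [(B + 2) * lam ^+ n], so the ball contains it and has at least
    the probability of the word as its mass. *)
Lemma ball_mass_ge e : 0 < e -> {ae mu, forall x : measurableTypeR R, \forall n \near \oo,
  expR (- (n%:R * (h + e))) <= ball_mass x ((B + 3) * lam ^+ n)}.
Proof.
move=> e0; have [r r01 H] := light_words p_pos e0.
pose W n w := expR (- (n%:R * (h + e))) <= word_prob p w.
have : {ae mu, forall x : measurableTypeR R, \forall n \near \oo, ~ (~` tube (W n) (-1) (B + 1) n) x}.
  apply: (@borel_cantelli_geometric _ _ _ _ _ 1 r) => // [n|n].
    exact: measurableC.
  rewrite mul1r; apply: (@le_trans _ _
    (\sum_(w <- words n | word_prob p w < expR (- (n%:R * (h + e)))) word_prob p w)%:E%E).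
    apply: (self_similar_le lam01 ratioE transB p_pos mu_ss) => //.
      exact: measurableC.
    move=> w sw; rewrite -leNgt => Ww x /andP[x1 x2]; apply.
    by apply/tubeP; exists w => //; rewrite -/(val w); have lan := ln0 n; apply/andP; split; nra.
  by rewrite lee_fin.
apply: filterS => x; apply: filterS => n /contrapT /tubeP [w [sw Ww] /andP[x1 x2]].
apply: le_trans Ww _; rewrite -lee_fin -ball_massE.
apply: (self_similar_ge lam01 ratioE transB p_pos mu_ss) => //.
move=> y; rewrite /= !in_itv /= => /andP[y1 y2].
rewrite (word_mapE ratioE) sw -/(val w); have lan := ln0 n; apply/andP; split; nra.
Qed.

Hypothesis subexp : forall e : R, 0 < e -> exists2 K, 0 < K & forall n (x : R),
  (nearby lam (ifs_trans Phi) (2 * B + 3) n x)%:R <= K * expR (n%:R * e).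

(* Few words are near x, so if the ball at x has too large a mass, then x is
   near a word of too large a probability. Such words are few; the words near
   one of them are therefore few as well and carry little mass. *)
Lemma ball_mass_le e : 0 < e -> {ae mu, forall x : measurableTypeR R, \forall n \near \oo,
  ball_mass x (lam ^+ n) <= expR (- (n%:R * (h - e)))}.
Proof.
(* Three [d] separate the words that are too heavy from typical ones; one more is spent on the
   multiplicity and one on the constant [K]. *)
move=> e0; pose d := e / 5; have d0 : 0 < d by rewrite divr_gt0.
have [K K0 HK] := subexp d0; have [r /andP[r0 r1] Hr] := heavy_words p_pos d0.
pose W n w := expR (- (n%:R * (h - 3 * d))) < word_prob p w.
pose U n := tube (W n) (- (B + 2)) (B + 2) n.
have muU n : (mu (U n) <= ((1 + K) * (Num.max r (expR (- d))) ^+ n)%:E)%E.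
  (* [2 * B + 3] adds the reach [B + 1] of the image of [[-1, B + 1]] to the half-width [B + 2] of
     the tube. *)
  pose Q w' := has (fun w => W n w && (`|val w - val w'| <= (2 * B + 3) * lam ^+ n)) (words n).
  apply: (@le_trans _ _ (\sum_(w <- words n | Q w) word_prob p w)%:E%E).
    apply: (self_similar_le lam01 ratioE transB p_pos mu_ss); first exact: measurable_tube.
    move=> w' sw' /hasPn Qw' y /andP[y1 y2] /tubeP [w [sw Ww]].
    rewrite -/(val w') => /andP[z1 z2].
    have := Qw' w; rewrite mem_words sw eqxx Ww /= => /(_ isT) /negP; apply.
    have h1 := ler_wpM2l (ltW (ln0 n)) y1; have h2 := ler_wpM2l (ltW (ln0 n)) y2.
    have h3 := mulr_ge0 B0 (ltW (ln0 n)).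
    by rewrite ler_norml; apply/andP; split; lra.
  rewrite lee_fin big_mkcond /=.
  (* Words heavier than [c] have small total mass by [heavy_words]. The others in [Q] have mass at
     most [c] each, and their number is bounded by that of the words in [W n] times the
     multiplicity. *)
  pose c := expR (- (n%:R * (h - d))).
  apply: (@le_trans _ _ (\sum_(w <- words n | c < word_prob p w) word_prob p w +
      c * (\sum_(w <- words n) Q w)%N%:R)).
    rewrite natr_sum mulr_sumr [X in _ <= X + _]big_mkcond /= -big_split /= ler_sum // => w _.
    have pw := ltW (word_prob_gt0 p_pos w); have c0 : 0 <= c := expR_ge0 _.
    case: (Q w) => /=; rewrite ?mulr1 ?mulr0; case: ltP => ?; lra.
  have Qle : (\sum_(w <- words n) Q w)%N%:R <= expR (n%:R * (h - 3 * d)) * (K * expR (n%:R * d)).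
    apply: (@le_trans _ _ (\sum_(w <- words n) \sum_(w' <- words n)
       (W n w' : nat) * (`|val w' - val w| <= (2 * B + 3) * lam ^+ n)%R)%N%:R).
      rewrite ler_nat leq_sum // => w _; rewrite /Q.
      elim: (words n) => [|w' s IH] /=; first by rewrite big_nil.
      by rewrite big_cons; case: (W n w'); case: (_ <= _) => //=; rewrite ?mul0n ?muln0 ?add0n.
    rewrite exchange_big /= natr_sum.
    apply: (@le_trans _ _ (\sum_(w <- words n) (W n w)%:R * (K * expR (n%:R * d)))).
      rewrite ler_sum // => w _; rewrite -big_distrr /= natrM ler_wpM2l //.
      apply: le_trans (HK n (val w)); rewrite ler_nat /nearby leq_sum // => w' _.
      by rewrite distrC.
    rewrite -mulr_suml ler_wpM2r ?mulr_ge0 ?expR_ge0 ?(ltW K0) // -natr_sum.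
    exact: (card_heavy_words p_pos (n%:R * (h - 3 * d))).
  have cQ : c * (\sum_(w <- words n) Q w)%N%:R <= K * (expR (- d)) ^+ n.
    apply: le_trans (ler_wpM2l (expR_ge0 _) Qle) _.
    rewrite /c mulrCA mulrA mulrCA -!expRD -expRM_natl.
    by rewrite ler_wpM2l ?(ltW K0) // ler_expR; lra.
  apply: le_trans (lerD (Hr n) cQ) _.
  rewrite mulrDl mul1r lerD //.
    by rewrite lerXn2r ?nnegrE // le_max ?r0 ?lexx.
  by rewrite ler_wpM2l ?(ltW K0) // lerXn2r ?nnegrE ?le_max ?r0 ?expR_ge0 ?lexx ?orbT.
have : {ae mu, forall x : measurableTypeR R, \forall n \near \oo, ~ U n x}.
  apply: (@borel_cantelli_geometric _ _ _ _ _ (1 + K) (Num.max r (expR (- d)))) => //.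
  - by move=> n; exact: measurable_tube.
  - by rewrite le_max r0 gt_max r1 -expR0 ltr_expR oppr_lt0.
  - by rewrite addr_ge0 // ltW.
have largeK : \forall n \near \oo, K <= expR (n%:R * d).
  near=> n; apply: le_trans (expR_ge1Dx _); apply: (@le_trans _ _ (n%:R * d)); last lra.
  by rewrite -ler_pdivrMr //; near: n; exact: nbhs_infty_ger.
apply: filterS => x; apply: filterS2 largeK => n Kn xU.
rewrite -lee_fin -ball_massE.
(* Only words this close to [x] charge the ball, and none of them is in [W n], since [x] is outside
   the tube. *)
apply: (@le_trans _ _ (\sum_(w <- words n | `|val w - x| <= (B + 2) * lam ^+ n) word_prob p w)%:E%E).
  apply: (self_similar_le lam01 ratioE transB p_pos mu_ss) => //.
  move=> w sw wx y /andP[y1 y2]; rewrite /= in_itv /= -/(val w) => /andP[z1 z2].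
  move: wx; rewrite ler_norml; apply/negP; rewrite negbK.
  have h1 := ler_wpM2l (ltW (ln0 n)) y1; have h2 := ler_wpM2l (ltW (ln0 n)) y2.
  have h3 := mulr_ge0 B0 (ltW (ln0 n)).
  by apply/andP; split; lra.
rewrite lee_fin; pose c := expR (- (n%:R * (h - 3 * d))).
apply: (@le_trans _ _ (c * (nearby lam (ifs_trans Phi) (2 * B + 3) n x)%:R)).
  rewrite /nearby natr_sum mulr_sumr big_mkcond /= big_seq [leRHS]big_seq ler_sum // => w.
  rewrite mem_words => /eqP sw; have c0 : 0 <= c := expR_ge0 _.
  rewrite -/(val w); case: ifPn => [wx|_]; last by rewrite mulr_ge0.
  have -> : `|val w - x| <= (2 * B + 3) * lam ^+ n.
    by apply: le_trans wx _; have b0 : 0 <= B := B0; rewrite ler_pM2r //; lra.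
  rewrite mulr1 leNgt; apply/negP => Ww; apply: xU; apply/tubeP; exists w => //.
  by move: wx; rewrite ler_norml => /andP[? ?]; apply/andP; split; nra.
apply: (@le_trans _ _ (c * (expR (n%:R * d) * expR (n%:R * d)))).
  rewrite ler_wpM2l ?expR_ge0 //; apply: le_trans (HK n x) _.
  by rewrite ler_pM2r ?expR_gt0.
by rewrite /c -!expRD ler_expR /d; lra.
Unshelve. all: by end_near. Qed.


(** The exceptional null sets depend on [e], so only the countably many values [k.+1%:R^-1] are
    used. *)
Lemma exact_dim_self_similar : is_exact_dim mu (h / - ln lam).
Proof.
have ge_ae : {ae mu, forall x : measurableTypeR R, forall k : nat, \forall n \near \oo,
    expR (- (n%:R * (h + k.+1%:R^-1))) <= ball_mass x ((B + 3) * lam ^+ n)}.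
  by apply/ae_foralln => k; apply: ball_mass_ge; rewrite invr_gt0.
have le_ae : {ae mu, forall x : measurableTypeR R, forall k : nat, \forall n \near \oo,
    ball_mass x (lam ^+ n) <= expR (- (n%:R * (h - k.+1%:R^-1)))}.
  by apply/ae_foralln => k; apply: ball_mass_le; rewrite invr_gt0.
have small (e : R) : 0 < e -> exists k : nat, k.+1%:R^-1 <= e.
  move=> e0; exists (Num.bound e^-1).
  rewrite -[leRHS]invrK lef_pV2 ?posrE ?invr_gt0 // -natr1.
  by rewrite ltW // ltr_wpDr // archi_boundP // invr_ge0 ltW.
apply: filterS2 ge_ae le_ae => x ge_x le_x.
apply: (log_ratio_cvg lam01 (_ : 0 < B + 3)).
- by have b0 : 0 <= B := B0; lra.
- by move=> d d' _; exact: ball_mass_nd.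
- move=> e /small [k ke]; apply: filterS (ge_x k) => n; apply: le_trans.
  by rewrite ler_expR lerN2 ler_wpM2l // lerD2l.
- move=> e /small [k ke]; apply: filterS (le_x k) => n; move/le_trans; apply.
  by rewrite ler_expR lerN2 ler_wpM2l // lerB.
Qed.

Lemma measure_dim_self_similar : measure_dim mu = h / - ln lam.
Proof.
have ex := exact_dim_self_similar.
suff uniq d : is_exact_dim mu d -> d = h / - ln lam.
  by rewrite /measure_dim; case: xgetP => [d _ /uniq //|/(_ _ ex)].
move=> exd; have : {ae mu, forall x : measurableTypeR R, d = h / - ln lam}.
  apply: filterS2 exd ex => x h1 h2.
  by rewrite -(cvg_lim _ h1) // (cvg_lim _ h2).
move=> [N [mN N0 sub]]; apply: contrapT => nd.
have : (mu setT <= mu N)%E by apply: le_measure; rewrite ?inE // => x _; apply: sub.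
by rewrite N0 probability_setT lee_fin ler10.
Qed.

End LocalDimension.

(** * Hausdorff dimension *)

Section Attractor.
Context {R : realType} {m : nat} (Phi : ifs R m) (lam B : R).
Hypothesis lam01 : 0 < lam < 1.
Hypothesis ratioE : forall j, ifs_ratio Phi j = lam.
Hypothesis transB : forall j, 0 <= ifs_trans Phi j <= (1 - lam) * B.

Let val := word_value lam (ifs_trans Phi).
Let l0 : 0 < lam. Proof. by case/andP: lam01. Qed.
Let l1 : lam < 1. Proof. by case/andP: lam01. Qed.
Let ln0 n : 0 < lam ^+ n. Proof. exact: exprn_gt0. Qed.
Let B0 : 0 <= B. Proof. exact: trans_bound_ge0 lam01 transB. Qed.

(** These are the images of [[-1, B + 1]]; dropping the last letter of a word enlarges its interval,
    so the unions decrease with [n]. *)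
Definition cylinders n : set R := \bigcup_(w in [set` @words 'I_m.+1 n])
  `[val w - lam ^+ n, val w + (B + 1) * lam ^+ n]%classic.

Lemma cylindersP n x : cylinders n x <->
  exists2 w, size w = n & val w - lam ^+ n <= x <= val w + (B + 1) * lam ^+ n.
Proof.
split=> [[w /= + wx]|[w sw wx]].
  by rewrite mem_words => /eqP sw; exists w.
by exists w => /=; rewrite ?mem_words ?sw ?in_itv.
Qed.

Lemma cylinders_closed n : closed (cylinders n).
Proof. by rewrite /cylinders bigcup_seq; apply: closed_bigsetU => w _; exact: itv_closed. Qed.

Lemma cylinders_decr n k : (n <= k)%N -> cylinders k `<=` cylinders n.
Proof.
move=> /subnKC <-; elim: (k - n)%N => [|i IH] x; first by rewrite addn0.
rewrite addnS => /cylindersP [w]; case/lastP: w => // w a; rewrite size_rcons => -[sw].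
rewrite /val word_value_rcons sw -/(val w) exprS => /andP[x1 x2]; apply: IH.
apply/cylindersP; exists w => //; have /andP[a0 a1] := transB a.
have h1 := mulr_ge0 (ltW (ln0 (n + i))) a0.
have h2 := ler_wpM2l (ltW (ln0 (n + i))) a1.
have h3 : lam * lam ^+ (n + i) <= lam ^+ (n + i) by rewrite ler_piMl // ltW.
by apply/andP; split; lra.
Qed.

Lemma attractor_exists : exists K : set R, is_attractor Phi K.
Proof.
exists (\bigcap_n cylinders n); split.
(* The fixed point of the map 0 lies in the cylinder of 0^n for all [n]. *)
- pose x0 := ifs_trans Phi ord0 / (1 - lam); have hl : 0 < 1 - lam by rewrite subr_gt0.
  have /andP[t0 tB] := transB ord0.
  exists x0 => n _; apply/cylindersP; exists (nseq n ord0); first by rewrite size_nseq.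
  have E : x0 = lam ^+ n * x0 + val (nseq n ord0).
    elim: n => [|n IH]; first by rewrite expr0 mul1r addr0.
    rewrite -[nseq n.+1 _]/(ord0 :: nseq n ord0) /val word_value_cons -/(val _).
    rewrite (_ : val (nseq n ord0) = x0 - lam ^+ n * x0); last by rewrite {1}IH addrAC subrr add0r.
    by rewrite exprS /x0; field; rewrite gt_eqF.
  have x00 : 0 <= x0 by rewrite divr_ge0 // ltW.
  have x0B : x0 <= B by rewrite ler_pdivrMr // mulrC.
  have h1 := mulr_ge0 (ltW (ln0 n)) x00; have h2 := ler_wpM2l (ltW (ln0 n)) x0B.
  by have := ln0 n; move: E; set y := val _ => E ln; apply/andP; split; lra.
- apply: (@subclosed_compact _ _ `[-1, B + 1]%classic).
  + by apply: closed_bigI => n _; exact: cylinders_closed.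
  + exact: segment_compact.
  + move=> x /(_ 0%N I) /cylindersP [w /size0nil -> /=].
    by rewrite in_itv /= expr0 /val /= !add0r mulr1.
apply/seteqP; split=> x.
  move=> Kx; pose y j := (x - ifs_trans Phi j) / lam.
  have [j Hj] : exists j, forall n, cylinders n (y j).
    (* Otherwise every letter [j] fails at some length [N j]; a word one longer than the largest of
       them contradicts this for its first letter. *)
    apply: contrapT => /forallNP H.
    have /fin_all_exists [N HN] (j : 'I_m.+1) : exists n, ~ cylinders n (y j).
      by apply/existsNP; exact: H.
    have /cylindersP [w] := Kx (\max_j N j).+1 I.
    case: w => // j w [sw]; rewrite /val word_value_cons -/(val w) exprS => /andP[x1 x2].
    apply: (HN j); apply: (@cylinders_decr _ (\max_i N i)); first exact: leq_bigmax.
    apply/cylindersP; exists w => //.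
    by rewrite ler_pdivlMr // ler_pdivrMr //; apply/andP; split; lra.
  exists j => //; exists (y j); first by move=> n _; exact: Hj.
  by rewrite /ifs_map ratioE /y mulrC divfK ?gt_eqF // subrK.
move=> [j _ [y Ky <-]] n _; rewrite /ifs_map ratioE.
apply: (@cylinders_decr _ n.+1) => //.
have /cylindersP [w sw /andP[y1 y2]] := Ky n I.
apply/cylindersP; exists (j :: w); first by rewrite /= sw.
rewrite /val word_value_cons -/(val w) exprS.
have := ler_wpM2l (ltW l0) y1; have := ler_wpM2l (ltW l0) y2.
by move=> h1 h2; apply/andP; split; lra.
Qed.

Lemma attractorP : is_attractor Phi (attractor Phi).
Proof. by have [K hK] := attractor_exists; exact: (xgetI _ hK). Qed.

Lemma attractor_words n : attractor Phi =
  \bigcup_(w in [set w | size w = n]) (word_map Phi w @` attractor Phi).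
Proof.
have [_ _ KE] := attractorP.
elim: n => [|n IH].
  apply/seteqP; split=> x; first by move=> Kx; exists [::] => //; exists x.
  by move=> [w /size0nil ->] [y Ky <-].
apply/seteqP; split=> x.
  rewrite {1}KE => -[j _ [y + <-]]; rewrite {1}IH => -[w /= sw [z Kz <-]].
  by exists (j :: w); rewrite /= ?sw //; exists z.
move=> [[//|j w] /= [sw]] [z Kz <-]; rewrite KE; exists j => //.
by exists (word_map Phi w z) => //; rewrite IH; exists w => //; exists z.
Qed.

(** [attractor] is a chosen solution of the fixed point equation. It is closed and contains the
    images of any of its points [y] under long words, which come arbitrarily close to [x]. *)
Lemma cylinders_sub_attractor : \bigcap_n cylinders n `<=` attractor Phi.
Proof.
have [[y Ky] cK _] := attractorP; move=> x Kx.
have : closed (attractor Phi) by apply: compact_closed => //; exact: Rhausdorff.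
apply=> V /nbhs_ballP [e /= e0 eV].
have [n hn] : exists n, lam ^+ n * (B + 1 + `|y|) < e.
  have C0 : 0 < B + 1 + `|y| by have := normr_ge0 y; have := B0; lra.
  have [n Hn] := geometric_small lam01 C0 (divr_gt0 e0 (ltr0Sn R 1)); exists n.
  by apply: le_lt_trans (Hn n (leqnn n)) _; rewrite ltr_pdivrMr // ltr_pMr // ltr1n.
have /cylindersP [w sw /andP[x1 x2]] := Kx n I.
exists (word_map Phi w y); split.
  by rewrite (attractor_words n); exists w => //; exists y.
apply: eV; rewrite /ball /= (word_mapE ratioE) sw -/(val w).
apply: le_lt_trans hn.
have yl : - `|y| <= y by rewrite lerNl -normrN ler_norm.
have h1 := ler_wpM2l (ltW (ln0 n)) (ler_norm y).
have h2 := ler_wpM2l (ltW (ln0 n)) yl.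
have h3 := mulr_ge0 (ltW (ln0 n)) B0.
by have := ln0 n => ln; rewrite ler_norml; apply/andP; split; lra.
Qed.

Lemma attractor_full p (mu : probability (measurableTypeR R) R) :
  pos_prob_vector p -> is_self_similar Phi p mu ->
  mu (~` \bigcap_n cylinders n) = 0%E.
Proof.
move=> p_pos mu_ss; rewrite setC_bigcap.
have mC n : measurable (cylinders n : set (measurableTypeR R)).
  by rewrite /cylinders bigcup_seq; apply: bigsetU_measurable => w _; exact: measurable_itv.
have C0 n : mu (~` cylinders n) = 0%E.
  apply/eqP; rewrite eq_le measure_ge0 andbT.
  (* Every word maps [[-1, B + 1]] into the cylinders, so none charges the complement. *)
  have -> : 0%E = (\sum_(w <- words n | pred0 w) word_prob p w)%:E by rewrite big_pred0.
  apply: (self_similar_le lam01 ratioE transB p_pos mu_ss); first exact: measurableC.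
  move=> w sw _ x /andP[x1 x2]; apply; apply/cylindersP; exists w => //.
  rewrite -/(val w); have h1 := ler_wpM2l (ltW (ln0 n)) x1.
  by have h2 := ler_wpM2l (ltW (ln0 n)) x2; apply/andP; split; lra.
apply/eqP; rewrite eq_le measure_ge0 andbT.
apply: le_trans (measure_sigma_subadditive _ _ _ _) _.
- exact: (fun n => measurableC (mC n)).
- by apply: bigcup_measurable => n _; exact: measurableC.
- exact: subset_refl.
- by rewrite eseries0 // => i _ _; exact: C0.
Qed.

End Attractor.

Section Diameter.
Context {R : realType}.
Implicit Types U : set R.

Lemma le_diam U x y : U x -> U y -> (`|x - y|%:E <= diam U)%E.
Proof. by move=> Ux Uy; apply: ereal_sup_ubound; exists (x, y). Qed.

Lemma diam_le U d : (forall x y, U x -> U y -> `|x - y| <= d) -> (diam U <= d%:E)%E.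
Proof.
by move=> H; apply: ge_ereal_sup => _ [[x y] [/= Ux Uy] <-]; rewrite lee_fin H.
Qed.

Lemma hausdorff_weight_ge0 s U : (0 <= hausdorff_weight s U)%E.
Proof. by rewrite /hausdorff_weight; case: ifP => // _; exact: poweR_ge0. Qed.

Lemma hausdorff_weight_le s U d : 0 <= s -> 0 <= d -> (diam U <= d%:E)%E ->
  (hausdorff_weight s U <= (d `^ s)%:E)%E.
Proof.
move=> s0 d0; rewrite /hausdorff_weight; case: ifPn => [_ _|/set0P[x Ux]].
  by rewrite lee_fin powR_ge0.
have := le_diam Ux Ux; rewrite subrr normr0.
case: (diam U) => // r; rewrite !lee_fin => r0 rd.
by apply: ge0_ler_powR; rewrite ?nnegrE.
Qed.

End Diameter.

(** * Upper bound by covers, lower bound by mass distribution *)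

Section HausdorffDimension.
Context {R : realType} {m : nat} (Phi : ifs R m) (lam B : R).
Hypothesis lam01 : 0 < lam < 1.
Hypothesis ratioE : forall j, ifs_ratio Phi j = lam.
Hypothesis transB : forall j, 0 <= ifs_trans Phi j <= (1 - lam) * B.

Let val := word_value lam (ifs_trans Phi).
Let l0 : 0 < lam. Proof. by case/andP: lam01. Qed.
Let l1 : lam < 1. Proof. by case/andP: lam01. Qed.
Let ln0 n : 0 < lam ^+ n. Proof. exact: exprn_gt0. Qed.
Let B0 : 0 <= B. Proof. exact: trans_bound_ge0 lam01 transB. Qed.
Let K := attractor Phi.
Let s := ln m.+1%:R / - ln lam.
Let L0 : 0 < - ln lam. Proof. by rewrite oppr_gt0 ln_lt0. Qed.

(** The images of [K] under the words of length [n] cover [K], with total weight at most a constant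
    times [q ^+ n]; here [q < 1] because [s < s']. *)
Lemma hausdorff_measure_eq0 s' : s < s' -> hausdorff_measure s' K = 0%E.
Proof.
move=> ss'; have [[x0 Kx0] cK _] := attractorP lam01 ratioE transB.
have sl : 0 <= s by rewrite /s divr_ge0 ?ln_ge0 ?ler1n // ltW.
have s'0 : 0 < s' := le_lt_trans sl ss'.
have [D D0 HD] : exists2 D, 0 < D & forall x y, K x -> K y -> `|x - y| <= D.
  have [M [_ HM]] := compact_bounded cK.
  have /(_ (`|M| + 1)) := HM _; rewrite ltr_pwDr ?ler_norm // => /(_ isT) HM1.
  exists (2 * (`|M| + 1)); first by rewrite mulr_gt0 // ltr_wpDl.
  move=> x y /HM1 /= hx /HM1 /= hy; rewrite (le_trans (ler_normB _ _)) //.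
  by move: hx hy; rewrite /=; lra.
pose q := m.+1%:R * lam `^ s'.
have q01 : 0 < q < 1.
  have -> : q = expR ((s - s') * - ln lam).
    rewrite mulrBl /s divfK ?gt_eqF // expRD lnK ?posrE ?ltr0n //; congr (_ * _).
    by rewrite /powR gt_eqF // mulrN opprK.
  by rewrite expR_gt0 -[ltRHS]expR0 ltr_expR nmulr_rlt0 // subr_lt0.
have content d : 0 < d -> hausdorff_content s' d K = 0%E.
  move=> d0; apply/eqP; rewrite eq_le; apply/andP; split; last first.
    apply: le_ereal_inf_tmp => _ [U _ <-]; apply: nneseries_ge0 => i _ _.
    exact: hausdorff_weight_ge0.
  apply/lee_addgt0Pr => e e0; rewrite add0e.
  have [n [n1 n2]] : exists n, D * lam ^+ n <= d /\ q ^+ n * D `^ s' <= e.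
    have [N1 h1] := geometric_small lam01 D0 d0.
    have Ds : 0 < D `^ s' by rewrite powR_gt0.
    have [N2 h2] := geometric_small q01 Ds e0.
    exists (maxn N1 N2); split; last by rewrite h2 // leq_maxr.
    by rewrite mulrC h1 // leq_maxl.
  pose W := @words 'I_m.+1 n; pose w0 : seq 'I_m.+1 := [::].
  pose U i := if (i < size W)%N then word_map Phi (nth w0 W i) @` K else set0.
  have dU i : (diam (U i) <= (D * lam ^+ n)%:E)%E.
    apply: diam_le => x y; rewrite /U; case: ifPn => // iW [x' Kx' <-] [y' Ky' <-].
    have /eqP sw : size (nth w0 W i) == n by rewrite -mem_words mem_nth.
    rewrite !(word_mapE ratioE) sw opprD addrACA subrr addr0 -mulrBr normrM.
    by rewrite (gtr0_norm (ln0 n)) mulrC ler_pM2r // HD.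
  apply: (@le_trans _ _ (\sum_(0 <= i <oo) hausdorff_weight s' (U i))%E).
    apply: ereal_inf_lbound; exists U => //; split.
      rewrite {1}/K (attractor_words lam01 ratioE transB n) => x [w /= sw [y Ky <-]].
      have wW : w \in W by rewrite mem_words sw.
      exists (index w W) => //; rewrite /U index_mem wW nth_index //.
    by move=> i; apply: le_trans (dU i) _; rewrite lee_fin.
  rewrite (nneseries_split 0 (size W)); last by move=> *; exact: hausdorff_weight_ge0.
  rewrite add0n [X in (_ + X)%E]eseries0 ?adde0; last first.
    move=> i Wi _; rewrite /U ltnNge Wi /= /hausdorff_weight eqxx //.
  apply: (@le_trans _ _ (\sum_(0 <= i < size W) ((D * lam ^+ n) `^ s')%:E)%E).
    apply: lee_sum => i _; apply: hausdorff_weight_le; rewrite ?(ltW s'0) //.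
    by rewrite mulr_ge0 // ltW.
  rewrite sumEFin lee_fin sumr_const_nat subn0 size_words card_ord.
  rewrite powRM ?(ltW D0) ?(ltW (ln0 n)) // -powR_mulrn ?(ltW l0) //.
  rewrite -powRrM [n%:R * _]mulrC powRrM powR_mulrn ?powR_ge0 //.
  by rewrite -[_ *+ _]mulr_natl natrX mulrCA -exprMn mulrC.
rewrite /hausdorff_measure; apply/eqP; rewrite eq_le; apply/andP; split.
  by apply: ge_ereal_sup => _ [d /= d0 <-]; rewrite content.
by apply: ereal_sup_ubound; exists 1 => //=; rewrite content.
Qed.

Hypothesis subexp : forall e : R, 0 < e -> exists2 C, 0 < C & forall n (x : R),
  (nearby lam (ifs_trans Phi) (2 * B + 3) n x)%:R <= C * expR (n%:R * e).

(** For equal probabilities the mass of a ball of radius [lam ^+ n] is at most [m.+1%:R ^- n] times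
    the multiplicity, which the gap between [s'] and [s] absorbs. *)
Lemma frostman s' : 0 <= s' < s -> exists2 mu : probability (measurableTypeR R) R,
  mu (~` \bigcap_n cylinders Phi lam B n) = 0%E &
  exists2 C, 0 < C & forall U : set R, (diam U <= 1%:E)%E ->
    exists2 V : set (measurableTypeR R), measurable V /\ U `<=` V &
      (mu V <= C%:E * hausdorff_weight s' U)%E.
Proof.
move=> /andP[s'0 s's]; pose L := - ln lam; have L0' : 0 < L := L0.
pose p (j : 'I_m.+1) : R := m.+1%:R^-1.
have p_pos : pos_prob_vector p.
  split=> [j|]; first by rewrite invr_gt0 ltr0n.
  by rewrite sumr_const card_ord -[_ *+ _]mulr_natr mulVf // pnatr_eq0.
have mu_ss := self_similar_measureP lam01 ratioE transB p_pos.
set mu := self_similar_measure Phi p in mu_ss; exists mu.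
  exact: (attractor_full lam01 ratioE transB p_pos mu_ss).
have d0 : 0 < ln m.+1%:R - s' * L by rewrite subr_gt0 -ltr_pdivlMr.
have [C C0 HC] := subexp d0.
have small n (x r : R) : 0 <= r <= lam ^+ n ->
    (mu `[(x - r)%R, (x + r)%R]%classic <= (C * expR (- (n%:R * (s' * L))))%:E)%E.
  move=> /andP[r0 rn].
  apply: (@le_trans _ _ (\sum_(w <- words n | `|val w - x| <= (2 * B + 3) * lam ^+ n)
      word_prob p w)%:E%E).
    apply: (self_similar_le lam01 ratioE transB p_pos mu_ss) => //.
    move=> w sw wx y /andP[y1 y2]; rewrite /= in_itv /= -/(val w) => /andP[z1 z2].
    move: wx; rewrite ler_norml; apply/negP; rewrite negbK.
    have h1 := ler_wpM2l (ltW (ln0 n)) y1; have h2 := ler_wpM2l (ltW (ln0 n)) y2.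
    have h3 := mulr_ge0 (ltW (ln0 n)) B0; have h4 := ln0 n.
    by apply/andP; split; lra.
  rewrite lee_fin.
  have -> : \sum_(w <- words n | `|val w - x| <= (2 * B + 3) * lam ^+ n) word_prob p w =
      expR (- (n%:R * ln m.+1%:R)) * (nearby lam (ifs_trans Phi) (2 * B + 3) n x)%:R.
    rewrite /nearby natr_sum mulr_sumr big_mkcond /= big_seq [RHS]big_seq.
    apply: eq_bigr => w; rewrite mem_words => /eqP sw; rewrite -/(val w).
    case: (_ <= _) => /=; rewrite ?mulr0 ?mulr1 //.
    rewrite /word_prob big_const_seq count_predT sw iter_mulr_1 expRN expRM_natl.
    by rewrite lnK ?posrE ?ltr0n // exprVn.
  apply: le_trans (ler_wpM2l (expR_ge0 _) (HC n x)) _.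
  by rewrite mulrCA -expRD ler_pM2l // ler_expR; lra.
have C'0 : 0 < C * expR (s' * L) by rewrite mulr_gt0 // expR_gt0.
exists (C * expR (s' * L)) => // U U1.
have [->|/set0P[x Ux]] := eqVneq U set0.
  by exists set0; [split|rewrite measure0 mule_ge0 // ?hausdorff_weight_ge0 // lee_fin ltW].
have := le_diam Ux Ux; rewrite subrr normr0.
have : forall y, U y -> (`|x - y|%:E <= diam U)%E by move=> y; exact: le_diam.
rewrite /hausdorff_weight; have /negbTE -> : U != set0 by apply/set0P; exists x.
case: (diam U) U1 => // r; rewrite !lee_fin => r1 Ur r0.
exists (`[x - r, x + r]%classic : set (measurableTypeR R)).
  split => // y Uy; rewrite /= in_itv /=; have := Ur y Uy; rewrite lee_fin ler_norml.
  by move=> /andP[? ?]; apply/andP; split; lra.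
rewrite poweR_EFin -EFinM.
have [r00|r00] := ltP 0 r.
  (* [n] is the largest with [r <= lam ^+ n]; replacing [lam ^+ n] by [r] costs at most the factor
     [expR (s' * L)]. *)
  pose n := Num.truncn (- ln r / L).
  have lr : 0 <= - ln r by rewrite oppr_ge0 ln_le0.
  have /andP[n1 n2] : n%:R <= - ln r / L < n.+1%:R.
    by apply: truncn_itv; rewrite divr_ge0 // ltW.
  rewrite ler_pdivlMr // in n1; rewrite ltr_pdivrMr // in n2.
  apply: (@le_trans _ _ (C * expR (- (n%:R * (s' * L))))%:E%E).
    apply: small; rewrite r0 /= -[leLHS]lnK ?posrE // -[lam]lnK ?posrE // -expRM_natl.
    by rewrite ler_expR; move: n1; rewrite /L mulrN lerN2.
  rewrite lee_fin /powR gt_eqF // -mulrA ler_pM2l // -expRD ler_expR.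
  rewrite -natr1 in n2; have := ler_wpM2l s'0 (ltW n2); lra.
have r_eq0 : r = 0 by apply/eqP; rewrite eq_le r0 r00.
rewrite r_eq0 in small *.
(* A set of diameter 0 has weight 1 for [s' = 0], by the convention 0^0 = 1. For [s' > 0] its weight
   is 0, and a point is null by letting the scale tend to 0. *)
have [s'_eq0|s'_neq0] := eqVneq s' 0.
  apply: le_trans (small 0%N x 0 _) _; first by rewrite lexx expr0 ler01.
  by rewrite lee_fin s'_eq0 powRr0 !mul0r ?mulr0 ?oppr0 expR0 !mulr1.
have s'_gt0 : 0 < s' by rewrite lt_def s'_neq0.
rewrite powR0 // mulr0; apply/lee_addgt0Pr => e e0; rewrite add0e.
have e01 : 0 < expR (- (s' * L)) < 1.
  by rewrite expR_gt0 -[ltRHS]expR0 ltr_expR oppr_lt0 mulr_gt0.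
have [N HN] := geometric_small e01 C0 e0.
apply: le_trans (small N x 0 _) _; first by rewrite lexx ltW.
by rewrite lee_fin -mulrN expRM_natl mulrC HN.
Qed.

(** A cover of total weight below [C^-1 / 2] would have mass below 1/2, but it contains the
    intersection of the cylinders, of mass 1. *)
Lemma hausdorff_measure_neq0 s' : 0 <= s' < s -> hausdorff_measure s' K != 0%E.
Proof.
move=> s's; have [mu mu0 [C C0 HC]] := frostman s's.
apply/negP => /eqP H0.
have : (hausdorff_content s' 1 K < (C^-1 / 2)%:E)%E.
  apply: (@le_lt_trans _ _ (hausdorff_measure s' K)).
    by apply: ereal_sup_ubound; exists 1 => //=.
  by rewrite H0 lte_fin divr_gt0 // invr_gt0.
move=> /ereal_inf_lt [_ [U [KU dU] <-]].
have /choice [V HV] i : exists V : set (measurableTypeR R),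
    (measurable V /\ U i `<=` V) /\ (mu V <= C%:E * hausdorff_weight s' (U i))%E.
  by have [V h1 h2] := HC _ (dU i); exists V.
set S := (\sum_(0 <= i <oo) _)%E => Slt.
have S0 : (0 <= S)%E by apply: nneseries_ge0 => i _ _; exact: hausdorff_weight_ge0.
have mC n : measurable (cylinders Phi lam B n : set (measurableTypeR R)).
  by rewrite /cylinders bigcup_seq; apply: bigsetU_measurable => w _; exact: measurable_itv.
have mI : measurable (\bigcap_n cylinders Phi lam B n : set (measurableTypeR R)).
  exact: bigcapT_measurable.
have : (mu (\bigcap_n cylinders Phi lam B n) <= C%:E * S)%E.
  apply: (@le_trans _ _ (\sum_(0 <= i <oo) mu (V i))%E).
    apply: measure_sigma_subadditive => //; first by move=> i; case: (HV i) => [[]].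
    move=> x /(cylinders_sub_attractor lam01 ratioE transB) /KU [i _ Ux].
    by exists i => //; case: (HV i) => [[_ h] _]; exact: h.
  rewrite /S -nneseriesZl; last by move=> *; exact: hausdorff_weight_ge0.
  by apply: lee_nneseries => // i _; case: (HV i).
have -> : mu (\bigcap_n cylinders Phi lam B n) = 1%E.
  by rewrite -[X in mu X]setCK probability_setC ?mu0 ?sube0 //; exact: measurableC.
move: S0 Slt; case: S => // S; rewrite -EFinM !lee_fin lte_fin => S0 Slt h.
have : C * S < C * (C^-1 / 2) by rewrite ltr_pM2l.
by rewrite mulrA divff ?gt_eqF // => ?; lra.
Qed.

Lemma hausdorff_dim_attractor : hausdorff_dim K = s%:E.
Proof.
have sl : 0 <= s by rewrite /s divr_ge0 ?ln_ge0 ?ler1n // ltW.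
apply/eqP; rewrite eq_le; apply/andP; split.
  apply/lee_addgt0Pr => e e0; apply: ereal_inf_lbound; exists (s + e) => //; split.
    by rewrite addr_ge0 // ltW.
  by apply: hausdorff_measure_eq0; rewrite ltrDl.
apply: le_ereal_inf_tmp => _ [s' [s'0 Hs'] <-]; rewrite lee_fin leNgt.
apply/negP => lt; have := @hausdorff_measure_neq0 s'; rewrite s'0 lt => /(_ isT).
by rewrite Hs' eqxx.
Qed.

End HausdorffDimension.

(** * The system *)

(** Gibbs' inequality, from [1 + y <= expR y] at [y = - ln (p j) - ln m.+1%:R]. *)
Lemma nat_entropy_le {R : realType} {m : nat} (p : 'I_m.+1 -> R) :
  pos_prob_vector p -> nat_entropy p <= ln m.+1%:R.
Proof.
move=> [p0 p1].
have step j : p j * (- ln (p j) - ln m.+1%:R) <= m.+1%:R^-1 - p j.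
  have := expR_ge1Dx (- ln (p j) - ln m.+1%:R).
  rewrite expRD !expRN !lnK ?posrE ?ltr0n // => h.
  have := ler_wpM2l (ltW (p0 j)) h.
  rewrite [in leRHS]mulrA divff ?gt_eqF // mul1r. 
  by move: (ln (p j)) (ln _) (_^-1) => a b c; lra.
have := ler_sum (index_enum _) (fun j (_ : true) => step j).
rewrite sumrB p1 sumr_const card_ord -(mulr_natr (m.+1%:R^-1)) mulVf ?pnatr_eq0 // subrr.
under eq_bigr do rewrite mulrBr mulrN.
by rewrite sumrB sumrN -mulr_suml p1 mul1r /nat_entropy; lra.
Qed.

Section Homogeneous.
Context {R : realType} {m : nat} (Phi : ifs R m) (lam : R).
Hypothesis lam01 : 0 < lam < 1.
Hypothesis ratioE : forall j, ifs_ratio Phi j = lam.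

Let l0 : 0 < lam. Proof. by case/andP: lam01. Qed.
Let L0 : 0 < - ln lam. Proof. by rewrite oppr_gt0 ln_lt0. Qed.
Let ln2 : 0 < ln 2 :> R. Proof. by rewrite ln_gt0 // ltr1n. Qed.

Lemma similarity_dim_homogeneous : similarity_dim Phi = ln m.+1%:R / - ln lam.
Proof.
apply/esym/similarity_dim_unique; split.
  by rewrite divr_ge0 ?ln_ge0 ?ler1n // ltW.
under eq_bigr do rewrite ratioE (gtr0_norm l0).
rewrite sumr_const card_ord /powR gt_eqF // -mulrA invrN mulNr mulVf; last first.
  by rewrite -oppr_eq0 gt_eqF.
by rewrite mulrN1 expRN lnK ?posrE ?ltr0n // -(mulr_natr (m.+1%:R^-1)) mulVf // pnatr_eq0.
Qed.

Lemma entropy_lyapunov_homogeneous p : pos_prob_vector p ->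
  entropy p / lyapunov Phi p = nat_entropy p / - ln lam.
Proof.
move=> [p0 p1]; rewrite /entropy /lyapunov /nat_entropy /log2.
under eq_bigr do rewrite mulrA.
under [in X in _ / X]eq_bigr do rewrite ratioE (gtr0_norm l0).
rewrite -!mulr_suml p1 mul1r -!mulNr -mulf_div divff ?mulr1 //.
by rewrite invr_eq0 gt_eqF.
Qed.

Hypothesis m_lam : ln m.+1%:R < - ln lam.

Lemma beta_homogeneous p : pos_prob_vector p ->
  beta Phi p = nat_entropy p / - ln lam /\ nat_entropy p / - ln lam < 1.
Proof.
move=> hp; have lt1 : nat_entropy p / - ln lam < 1.
  by rewrite ltr_pdivrMr // mul1r (le_lt_trans (nat_entropy_le hp)).
split=> //; rewrite /beta entropy_lyapunov_homogeneous //.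
by apply/min_idPr; exact: ltW.
Qed.

End Homogeneous.

Section Overlaps.
Context {R : realType} {m : nat} (Phi : ifs R m) (lam : R).
Hypothesis lam01 : 0 < lam < 1.
Hypothesis ratioE : forall j, ifs_ratio Phi j = lam.

(** Free concatenation of two words of length [n] with equal values yields [2 ^ q] words of length
    [q * n] with one common value. *)
Lemma no_exact_overlaps (C : R) : 0 <= C ->
  (forall e : R, 0 < e -> exists2 K, 0 < K & forall n (x : R),
    (nearby lam (ifs_trans Phi) C n x)%:R <= K * expR (n%:R * e)) ->
  ~ exact_overlaps Phi.
Proof.
move=> C0 subexp [n [n0 [w1 [w2 [w12 E]]]]].
have /andP[l0 l1] := lam01; pose val := word_value lam (ifs_trans Phi).
have vE : val w1 = val w2.
  have := congr1 (fun f => f 0) E; rewrite /= !(word_mapE ratioE).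
  by rewrite !mulr0 !add0r.
have many q : exists x, (2 ^ q <= \sum_(w <- words (q * n)) (val w == x))%N.
  elim: q => [|q [x IH]].
    by exists 0; rewrite mul0n big_words0 /val /= eqxx.
  exists (val w1 + lam ^+ n * x); rewrite mulSn big_words_cat.
  have in1 : tval w1 \in words n by rewrite mem_words size_tuple.
  have in2 : tval w2 \in words n by rewrite mem_words size_tuple.
  have shift (w : seq 'I_m.+1) : size w = n -> val w = val w1 ->
      (\sum_(u <- words (q * n)) (val u == x) <=
       \sum_(u <- words (q * n)) (val (w ++ u) == val w1 + lam ^+ n * x)%R)%N.
    move=> sw vw; rewrite leq_sum // => u _.
    rewrite /val word_value_cat sw -/(val w) -/(val u) vw.
    by case: eqP => // ->; rewrite eqxx.
  have in2' : tval w2 \in rem (tval w1) (words n).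
    by rewrite mem_rem_uniq ?uniq_words // inE in2 andbT; apply/eqP => /val_inj/esym.
  rewrite (big_rem _ in1) /= (big_rem _ in2') /=.
  rewrite addnA (leq_trans _ (leq_addr _ _)) // expnS mul2n -addnn leq_add //.
    by rewrite (leq_trans IH) // shift // size_tuple.
  by rewrite (leq_trans IH) // shift // size_tuple.
have nR : 0 < n%:R :> R by rewrite ltr0n.
have ln2 : 0 < ln 2 :> R by rewrite ln_gt0 // ltr1n.
(* At this rate the bound at length [q * n] is [K] times the square root of [2 ^ q], so this root
   would be at most [K] for all [q]. *)
have [K K0 HK] := subexp _ (divr_gt0 ln2 (mulr_gt0 (ltr0n _ 2) nR)).
have bound q : 1 + q%:R * (ln 2 / 2) <= K.
  have [x hx] := many q; have := HK (q * n)%N x.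
  have -> : (q * n)%:R * (ln 2 / (2 * n%:R)) = q%:R * (ln 2 / 2) :> R.
    by rewrite natrM; field; rewrite gt_eqF.
  have : (2 ^ q)%:R <= (nearby lam (ifs_trans Phi) C (q * n) x)%:R :> R.
    rewrite ler_nat (leq_trans hx) // leq_sum // => w _.
    case: (val w =P x) => // vx; rewrite -/(val w) vx subrr normr0.
    by rewrite mulr_ge0 // exprn_ge0 // ltW.
  have -> : (2 ^ q)%:R = expR (q%:R * (ln 2 / 2)) * expR (q%:R * (ln 2 / 2)) :> R.
    by rewrite -expRD -mulrDr -splitr expRM_natl lnK ?posrE // natrX.
  move=> h1 h2; have := le_trans h1 h2; rewrite ler_pM2r ?expR_gt0 //.
  by apply: le_trans; exact: expR_ge1Dx.
have := bound (Num.bound (K / (ln 2 / 2))); apply/negP; rewrite -ltNge.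
have : K / (ln 2 / 2) < (Num.bound (K / (ln 2 / 2)))%:R.
  by rewrite archi_boundP // divr_ge0 // ?ltW // divr_gt0.
by rewrite ltr_pdivrMr ?divr_gt0 // => h; rewrite ltr_wpDl.
Qed.

End Overlaps.

(** A [k] with [ln 4 / k.+1%:R <= e] is fixed, and [nearby_le_pow] carries the bound from the length
    [k.+1 * j] to all lengths. *)
Lemma controlled_subexp {R : realType} (C tau sigma : R) :
  0 <= tau <= 8 -> 0 <= sigma <= 8 -> 21 <= C ->
  (forall k, exists2 j, (0 < j)%N & controlled C k tau sigma j) ->
  forall e : R, 0 < e -> exists2 K, 0 < K & forall n (x : R),
    (nearby 10^-1 (translations tau sigma) C n x)%:R <= K * expR (n%:R * e).
Proof.
move=> t8 s8 C21 ctl e e0.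
have l01 : 0 < (10^-1 : R) < 1 by apply/andP; split; lra.
have ln4 : 0 < ln 4 :> R by rewrite ln_gt0 // ltr1n.
have [k ke] : exists k : nat, ln 4 / k.+1%:R <= e.
  exists (Num.bound (ln 4 / e)); rewrite ler_pdivrMr ?ltr0n // mulrC -ler_pdivrMr //.
  rewrite -[leRHS]natr1; have : ln 4 / e < (Num.bound (ln 4 / e))%:R.
    by rewrite archi_boundP // divr_ge0 // ltW.
  by move=> h; rewrite (le_trans (ltW h)) // lerDl.
have [j j0 Hj] := ctl k; pose l := (k.+1 * j)%N.
exists (6 ^ l)%:R; first by rewrite ltr0n expn_gt0.
(* The translations are at most 8, which is below [(1 - 10^-1) * 9]. *)
move=> n x; have value9 w : `|word_value 10^-1 (translations tau sigma) w| <= 9.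
  have /andP[v0 v9] : 0 <= word_value 10^-1 (translations tau sigma) w <= 9.
    apply: word_value_bound => // a; move: t8 s8 => /andP[? ?] /andP[? ?].
    by case: a => [[|[|[|[|[|[|//]]]]]] a6]; rewrite /translations /=; apply/andP; split; lra.
  by rewrite ger0_norm.
apply: (@le_trans _ _ (6 ^ l * (4 ^ j) ^ (n %/ l))%N%:R).
  rewrite ler_nat -[6%N in leqRHS]card_ord.
  apply: (nearby_le_pow l01 value9) => //; rewrite ?card_ord ?expn_gt0 ?muln_gt0 //; lra.
rewrite natrM ler_pM2l ?ltr0n ?expn_gt0 // -expnM natrX.
rewrite -[in leLHS](lnK (_ : 4 \is Num.pos)) ?posrE // -expRM_natl ler_expR.
apply: (@le_trans _ _ (n%:R * (ln 4 / k.+1%:R))); last by rewrite ler_wpM2l.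
rewrite mulrA ler_pdivlMr ?ltr0n // mulrAC ler_pM2r // -natrM ler_nat.
by rewrite mulnC mulnA mulnC -/l leq_trunc_div.
Qed.

Lemma Delta_le {R : realType} {m : nat} (Phi : ifs R m) (lam d : R) n
    (u v : seq 'I_m.+1) :
  (forall j, ifs_ratio Phi j = lam) -> size u = n -> size v = n -> u <> v ->
  `|word_value lam (ifs_trans Phi) u - word_value lam (ifs_trans Phi) v| <= d ->
  (Delta Phi n <= d%:E)%E.
Proof.
move=> ratioE /eqP su /eqP sv uv uvd.
have ratio (w : seq 'I_m.+1) : size w = n -> word_ratio Phi w = lam ^+ n.
  move=> sw; rewrite /word_ratio; under eq_bigr do rewrite ratioE.
  by rewrite big_const_seq count_predT sw iter_mulr_1.
rewrite /Delta; apply/bigmin_leP; right; exists (Tuple su, Tuple sv) => /=.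
  rewrite !ratio ?(eqP su) ?(eqP sv) // eqxx andbT.
  by apply/eqP => /(congr1 val).
by rewrite lee_fin !(word_mapE ratioE) !mulr0 !add0r.
Qed.

Definition decimal_ifs {R : realType} (tau sigma : R) : ifs R 5.
Proof.
refine (@Ifs R 5 (fun=> 10^-1) (translations tau sigma) (fun=> _) (fun=> _)).
  by rewrite invr_eq0 pnatr_eq0.
by rewrite gtr0_norm ?invr_gt0 // invf_lt1 // ltr1n.
Defined.

Theorem corollary4 (R : realType) (eps : nat -> R)
    (eps_gt0 : forall n : nat, (1 <= n)%N -> 0 < eps n) :
  exists (m : nat) (Phi : ifs R m),
    [/\ (1 <= m)%N, homogeneous Phi &
    [/\ exists q : rat, forall j : 'I_m.+1, ifs_ratio Phi j = ratr q,
        ~ exact_overlaps Phi,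
        forall n : nat, (1 <= n)%N -> (Delta Phi n <= (eps n)%:E)%E,
        similarity_dim Phi < 1 /\
          (forall p : 'I_m.+1 -> R, pos_prob_vector p -> beta Phi p < 1) &
        (forall p : 'I_m.+1 -> R, pos_prob_vector p ->
          measure_dim (self_similar_measure Phi p) = beta Phi p) /\
        hausdorff_dim (attractor Phi) = (similarity_dim Phi)%:E]].
Proof.
(* This is the constant [2 * B + 3] of the dimension lemmas for the bound [B = 9] on the values. *)
have C0 : 0 <= 2 * 9 + 3 :> R by lra.
have [tau [sigma [t8 s8 ctl close]]] := parameters eps_gt0 C0.
have C21 : 21 <= 2 * 9 + 3 :> R by lra.
have subexp := controlled_subexp t8 s8 C21 ctl.
pose Phi := decimal_ifs tau sigma.
have l01 : 0 < (10^-1 : R) < 1 by apply/andP; split; lra.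
have ratioE j : ifs_ratio Phi j = 10^-1 by [].
have transB j : 0 <= ifs_trans Phi j <= (1 - 10^-1) * 9.
  move: t8 s8 => /andP[? ?] /andP[? ?].
  by case: j => [[|[|[|[|[|[|//]]]]]] j6]; rewrite /= /translations /=; apply/andP; split; lra.
(* Six maps of ratio 1/10 have similarity dimension below 1. *)
have ln610 : ln 6%:R < - ln 10^-1 :> R.
  by rewrite lnV ?posrE // opprK ltr_ln ?posrE // ltr_nat.
have betaE := beta_homogeneous l01 ratioE ln610.
exists 5, Phi; split=> //; split.
- by exists (10%:R^-1) => j; rewrite ratioE fmorphV /= ratr_nat.
- exact: (no_exact_overlaps l01 ratioE C0 subexp).
- move=> n /close [u [v [su sv uv uvn]]]; exact: (Delta_le ratioE su sv uv uvn).
- split=> [|p hp]; last by have [-> ->] := betaE p hp.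
  rewrite (similarity_dim_homogeneous l01 ratioE) ltr_pdivrMr ?mul1r //.
  by apply: lt_trans ln610; rewrite ln_gt0 // ltr1n.
- split=> [p hp|].
    have [-> _] := betaE p hp.
    apply: (measure_dim_self_similar l01 ratioE transB hp) => //.
    exact: (self_similar_measureP l01 ratioE transB hp).
  rewrite (hausdorff_dim_attractor l01 ratioE transB subexp).
  by rewrite (similarity_dim_homogeneous l01 ratioE).
Qed.
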